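(* Let $N\geqslant 2$ be an integer. The set of Cantor sets $M\subset\mathbb R^N$ that are in general position with respect to all projections is a dense $G_\delta$ subset of the space $\mathcal C(\mathbb R^N)$. Moreover, the set of Cantor sets $M\subset \ell_2$ that are in general position with respect to all projections with finite-dimensional kernels is a dense $G_\delta$ subset of the space $\mathcal C(\ell_2)$.
   Context: A Cantor set is a space homeomorphic to the standard middle-thirds Cantor set. For a complete metric space $X$, $\mathcal K(X)$ denotes the space of all non-empty compact subsets of $X$ with the Hausdorff metric, and $\mathcal C(X)\subset \mathcal K(X)$ denotes the subspace of all Cantor sets in $X$ (with the induced topology). $\ell_2$ is the separable real Hilbert space. Let $X$ be $\mathbb R^N$ or $\ell_2$. For a non-zero proper linear subspace $H$ of $X$, let $p_H: X\to H^\perp$ be the orthogonal projection onto $H^\perp$. For a non-empty $M\subset X$ and $A\in M$, let $F(A)=(p_H|_M)^{-1}(p_H(A))$ be the fiber through $A$; it is non-degenerate if $|F(A)|>1$. With $k=\dim H$, $M$ is in general position with respect to $H$ if: $p_H|_M$ has only finitely many non-degenerate fibers; each non-degenerate fiber $F(A)$ consists of at most $k+1$ points which are the vertices of a simplex of dimension $|F(A)|-1$ (i.e. they are affinely independent); and $\sum_{A\in M}(|F(A)|-1)\leqslant k$ (the sum over distinct fibers). $M$ is in general position with respect to all projections if this holds for every non-zero proper linear subspace $H$ of $X$; $M\subset\ell_2$ is in general position with respect to all projections with finite-dimensional kernels if this holds for every non-zero finite-dimensional linear subspace $H$ of $\ell_2$. *)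

(* Defs.v *)
From Stdlib Require Import Reals List.
From Coquelicot Require Import Coquelicot.
Import ListNotations.
Open Scope R_scope.

(** Points: real sequences.  l2 = square-summable sequences; R^N is realised
    (isometrically) as the sequences vanishing from index N on. *)
Definition pt := nat -> R.

Definition l2 (x : pt) : Prop := ex_series (fun i => (x i) ^ 2).
Definition RN (N : nat) (x : pt) : Prop := forall i, (N <= i)%nat -> x i = 0.

Definition inner (x y : pt) : R := Series (fun i => x i * y i).
Definition dist (x y : pt) : R := sqrt (Series (fun i => (x i - y i) ^ 2)).

Fixpoint lcomb (cs : list R) (vs : list pt) : pt :=
  match cs, vs with
  | c :: cs', v :: vs' => fun n => c * v n + lcomb cs' vs' n
  | _, _ => fun _ => 0
  end.

Definition in_span (vs : list pt) (x : pt) : Prop :=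
  exists cs, length cs = length vs /\ forall n, x n = lcomb cs vs n.

Definition lin_indep (vs : list pt) : Prop :=
  forall cs, length cs = length vs -> (forall n, lcomb cs vs n = 0) ->
    (forall c, In c cs -> c = 0).

Definition aff_indep (ps : list pt) : Prop :=
  forall cs, length cs = length ps -> fold_right Rplus 0 cs = 0 ->
    (forall n, lcomb cs ps n = 0) -> (forall c, In c cs -> c = 0).

(** Orthogonal projection p_H onto H^perp, H = span vs, inside the ambient E:
    proj E vs x y  means  y = p_H(x). *)
Definition proj (E : pt -> Prop) (vs : list pt) (x y : pt) : Prop :=
  E y /\ in_span vs (fun n => x n - y n) /\ (forall v, In v vs -> inner y v = 0).

Definition fiber (E : pt -> Prop) (vs : list pt) (M : pt -> Prop) (A B : pt) : Prop :=
  M B /\ exists y, proj E vs A y /\ proj E vs B y.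

Definition enum_fiber E vs M (A : pt) (l : list pt) : Prop :=
  NoDup l /\ forall B, fiber E vs M A B <-> In B l.

Definition nondeg_fiber E vs M (A : pt) : Prop :=
  exists B, fiber E vs M A B /\ B <> A.

Definition gen_pos (E : pt -> Prop) (vs : list pt) (M : pt -> Prop) : Prop :=
  let k := length vs in
  (exists reps : list pt, forall A, M A -> nondeg_fiber E vs M A ->
       exists r, In r reps /\ M r /\ forall B, fiber E vs M A B <-> fiber E vs M r B) /\
  (forall A, M A -> nondeg_fiber E vs M A ->
       exists l, enum_fiber E vs M A l /\ (length l <= S k)%nat /\ aff_indep l) /\
  (forall ls : list (list pt), NoDup (concat ls) ->
       (forall l, In l ls -> exists A, M A /\ enum_fiber E vs M A l) ->
       (fold_right (fun l acc => (length l - 1) + acc) 0%nat ls <= k)%nat).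

Definition gp_all_proj_RN (N : nat) (M : pt -> Prop) : Prop :=
  forall vs : list pt, (forall v, In v vs -> RN N v) -> lin_indep vs -> vs <> [] ->
    (exists x, RN N x /\ ~ in_span vs x) -> gen_pos (RN N) vs M.

Definition gp_all_fin_proj_l2 (M : pt -> Prop) : Prop :=
  forall vs : list pt, (forall v, In v vs -> l2 v) -> lin_indep vs -> vs <> [] ->
    gen_pos l2 vs M.

Definition middle_thirds (t : R) : Prop :=
  exists a : nat -> bool, is_series (fun i => if a i then 2 / 3 ^ (S i) else 0) t.

Definition is_cantor (E : pt -> Prop) (M : pt -> Prop) : Prop :=
  (forall x, M x -> E x) /\
  exists (f : pt -> R) (g : R -> pt),
    (forall x, M x -> middle_thirds (f x) /\ g (f x) = x) /\
    (forall t, middle_thirds t -> M (g t) /\ f (g t) = t) /\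
    (forall x, M x -> forall eps, 0 < eps -> exists delta, 0 < delta /\
        forall y, M y -> dist x y < delta -> Rabs (f y - f x) < eps) /\
    (forall t, middle_thirds t -> forall eps, 0 < eps -> exists delta, 0 < delta /\
        forall s, middle_thirds s -> Rabs (s - t) < delta -> dist (g s) (g t) < eps).

Definition dist_to (B : pt -> Prop) (a : pt) : R :=
  real (Glb_Rbar (fun s => exists b, B b /\ s = dist a b)).
Definition exc (A B : pt -> Prop) : R :=
  real (Lub_Rbar (fun r => exists a, A a /\ r = dist_to B a)).
Definition hausdorff (A B : pt -> Prop) : R := Rmax (exc A B) (exc B A).

Definition open_in_C (E : pt -> Prop) (U : (pt -> Prop) -> Prop) : Prop :=
  forall K, is_cantor E K -> U K -> exists eps, 0 < eps /\
    forall L, is_cantor E L -> hausdorff K L < eps -> U L.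

Definition dense_Gdelta_in_C (E : pt -> Prop) (S : (pt -> Prop) -> Prop) : Prop :=
  (forall K, S K -> is_cantor E K) /\
  (exists U : nat -> (pt -> Prop) -> Prop, (forall n, open_in_C E (U n)) /\
     forall K, is_cantor E K -> (S K <-> forall n, U n K)) /\
  (forall K, is_cantor E K -> forall eps, 0 < eps ->
     exists L, S L /\ hausdorff K L < eps).

(* Main.v *)
(** Call a list of edges (a,b) a forest when each b differs from its a and from all
    vertices of the edges that follow it.  Counting edges inside the fibres and Steinitz
    exchange show that M is in general position exactly when, for every forest in M (with
    at most N edges in the case of R^N), the differences b - a are linearly independent.
    Linear independence survives small perturbations, so by compactness the requirement
    on the forests with at most n edges and with gaps at least 1/(n+1) defines an open
    set of Cantor sets; intersecting over n gives a G_delta.  For density, the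
    parametrisation of a Cantor set by binary sequences is perturbed along the binary
    tree: at each level the balls attached to the nodes are shrunk until every forest on
    the nodes is independent for all choices of points in the balls. *)

From Stdlib Require Import Reals List Lra Lia Classical FunctionalExtensionality.
From Stdlib Require Import IndefiniteDescription ClassicalEpsilon.
From Coquelicot Require Import Coquelicot.
Require Import Defs.
Import ListNotations.
Open Scope R_scope.

(** * Spans and independence *)


(** General position quantifies over uncountably many subspaces H and over whole fibres, and neither
    is visibly an open condition; forests replace H by the span of finitely many differences. Stars
    would control one fibre at a time, whereas the bound k on the sum couples the fibres, so edges
    must be spread over several of them. Conversely, a dependent forest whose tail of k edges is
    independent yields a k-dimensional H, the span of that tail, whose fibres hold k+1 edges. In R^N
    this H must be proper, that is k+1 <= N, whence the bound on the number of edges. As each b is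
    fresh, moving b alone changes a single difference, so a perturbation can treat one edge at a
    time. Distinctness is lost in limits, so compactness needs a gap in its place. The perturbation
    acts on labels (words, bit sequences) and not on points, because the two children of a node
    start at the same point; one-edge forests then make the limit map injective. *)

Lemma in_span_nil (x : pt) : in_span [] x <-> forall n, x n = 0.
Proof.
  split.
  - intros (cs & _ & H) n. rewrite H. destruct cs; reflexivity.
  - intros H. exists []. split; [reflexivity | exact H].
Qed.

Lemma in_span_cons (v : pt) (vs : list pt) (x : pt) :
  in_span (v :: vs) x <-> exists c s, in_span vs s /\ forall n, x n = c * v n + s n.
Proof.
  split.
  - intros ([|c cs] & Hl & H); [discriminate|].
    exists c, (lcomb cs vs). split; [|exact H].
    exists cs. split; [injection Hl; auto | reflexivity].
  - intros (c & s & (cs & Hl & Hs) & H). exists (c :: cs). split; [simpl; congruence|].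
    intros n. simpl. now rewrite H, Hs.
Qed.

Lemma in_span_ext (vs : list pt) (x y : pt) :
  in_span vs x -> (forall n, y n = x n) -> in_span vs y.
Proof. intros (cs & Hl & H) E. exists cs. split; [exact Hl|]. intros n. now rewrite E. Qed.

Lemma in_span_0 (vs : list pt) : in_span vs (fun _ => 0).
Proof.
  induction vs as [|v vs IH].
  - now apply in_span_nil.
  - apply in_span_cons. exists 0, (fun _ => 0). split; [exact IH|]. intros; ring.
Qed.

Lemma in_span_lin (vs : list pt) (c : R) (x y : pt) :
  in_span vs x -> in_span vs y -> in_span vs (fun n => c * x n + y n).
Proof.
  revert x y. induction vs as [|v vs IH]; intros x y Hx Hy.
  - rewrite in_span_nil in *. intros n. rewrite Hx, Hy. ring.
  - apply in_span_cons in Hx. apply in_span_cons in Hy. apply in_span_cons.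
    destruct Hx as (a & s & Hs & Ex). destruct Hy as (b & t & Ht & Ey).
    exists (c * a + b), (fun n => c * s n + t n). split; [now apply IH|].
    intros n. rewrite Ex, Ey. ring.
Qed.

Lemma in_span_In (vs : list pt) (v : pt) : In v vs -> in_span vs v.
Proof.
  induction vs as [|w vs IH]; intros [].
  - subst. apply in_span_cons. exists 1, (fun _ => 0). split; [apply in_span_0|]. intros; ring.
  - apply in_span_cons. exists 0, v. split; [auto|]. intros; ring.
Qed.

Lemma in_span_trans (vs ws : list pt) (x : pt) :
  (forall v, In v vs -> in_span ws v) -> in_span vs x -> in_span ws x.
Proof.
  revert x. induction vs as [|v vs IH]; intros x H Hx.
  - rewrite in_span_nil in Hx. eapply in_span_ext; [apply in_span_0|]. exact Hx.
  - apply in_span_cons in Hx. destruct Hx as (c & s & Hs & E).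
    eapply in_span_ext; [|exact E].
    apply in_span_lin; [apply H; now left | apply IH; [|exact Hs]].
    intros; apply H; now right.
Qed.

Lemma in_span_incl (vs ws : list pt) (x : pt) : incl vs ws -> in_span vs x -> in_span ws x.
Proof. intros H. apply in_span_trans. intros v Hv. apply in_span_In. auto. Qed.

Lemma in_span_sub (vs : list pt) (x y z : pt) :
  in_span vs (fun n => x n - z n) -> in_span vs (fun n => y n - z n) ->
  in_span vs (fun n => x n - y n).
Proof.
  intros Hx Hy. eapply in_span_ext; [exact (in_span_lin _ (-1) _ _ Hy Hx)|].
  intros n; simpl; ring.
Qed.

Lemma in_span_opp (vs : list pt) (x y : pt) :
  in_span vs (fun n => x n - y n) -> in_span vs (fun n => y n - x n).
Proof.
  intros H. eapply in_span_ext; [exact (in_span_lin _ (-1) _ _ H (in_span_0 vs))|].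
  intros n; simpl; ring.
Qed.

Lemma lin_indep_nil : lin_indep [].
Proof. intros [|] Hl _ c []; discriminate. Qed.

Lemma lin_indep_cons (v : pt) (vs : list pt) :
  lin_indep (v :: vs) <-> ~ in_span vs v /\ lin_indep vs.
Proof.
  split.
  - intros H. split.
    + intros (cs & Hl & E).
      assert (-1 = 0); [|lra].
      apply (H (-1 :: cs)); [simpl; congruence| |now left].
      intros n. simpl. rewrite E. ring.
    + intros cs Hl E c Hc. apply (H (0 :: cs)); [simpl; congruence| |now right].
      intros n. simpl. rewrite E. ring.
  - intros (Hv & H) [|c cs] Hl E c' Hc'; [discriminate|].
    injection Hl as Hl. simpl in E.
    assert (c = 0) as ->.
    { destruct (Req_dec c 0) as [|Hc]; [assumption|]. exfalso. apply Hv.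
      assert (S : in_span vs (lcomb cs vs)) by (exists cs; auto).
      eapply in_span_ext; [exact (in_span_lin _ (- / c) _ _ S (in_span_0 vs))|].
      intros n. specialize (E n). simpl.
      replace (lcomb cs vs n) with (- (c * v n)) by lra. now field. }
    destruct Hc' as [<-|Hc']; [reflexivity|].
    apply (H cs); auto. intros n. rewrite <- (E n). ring.
Qed.

(** Elements of [rest] are dropped from the front until the next removal would expel [w] from the
    span. The element [r] at that place has a non-zero coefficient in [w], so the relation can be
    solved for it. *)
Lemma span_exchange (A rest : list pt) (w : pt) :
  in_span (A ++ rest) w -> ~ in_span A w ->
  exists r1 r r2, rest = r1 ++ r :: r2 /\ in_span (w :: A ++ r1 ++ r2) r.
Proof.
  induction rest as [|r rest IH]; intros Hw HA.
  - rewrite app_nil_r in Hw. contradiction.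
  - destruct (classic (in_span (A ++ rest) w)) as [Hw'|Hw'].
    + destruct (IH Hw' HA) as (r1 & r' & r2 & -> & Hr).
      exists (r :: r1), r', r2. split; [reflexivity|].
      eapply in_span_incl; [|exact Hr].
      intros z. simpl. rewrite !in_app_iff. simpl. rewrite in_app_iff. tauto.
    + exists [], r, rest. split; [reflexivity|]. simpl.
      assert (Hw2 : in_span (r :: A ++ rest) w).
      { eapply in_span_incl; [|exact Hw]. intros z. simpl. rewrite !in_app_iff. simpl. tauto. }
      apply in_span_cons in Hw2. destruct Hw2 as (c & s & Hs & E).
      assert (Hc : c <> 0).
      { intros ->. apply Hw'. eapply in_span_ext; [exact Hs|]. intros n. rewrite E. ring. }
      apply in_span_cons. exists (/ c), (fun n => (- / c) * s n + 0). split.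
      * apply (in_span_lin _ (- / c) s (fun _ => 0)); [exact Hs | apply in_span_0].
      * intros n. rewrite E. now field.
Qed.

Lemma steinitz (vs ws : list pt) :
  lin_indep ws -> (forall w, In w ws -> in_span vs w) -> (length ws <= length vs)%nat.
Proof.
  intros Hi Hs.
  (* Invariant of the exchange: the vectors of [ws] have replaced equally many of [vs], and the rest
     still completes them to a spanning list. *)
  enough (exists rest, (length ws + length rest = length vs)%nat /\
    forall v, In v vs -> in_span (ws ++ rest) v) as (rest & H & _) by lia.
  induction ws as [|w ws IH].
  - exists vs. split; [reflexivity|]. intros; now apply in_span_In.
  - apply lin_indep_cons in Hi. destruct Hi as [Hw Hi].
    destruct IH as (rest & Hl & Hr); [exact Hi| intros; apply Hs; now right|].
    destruct (span_exchange ws rest w) as (r1 & r & r2 & -> & H); [|exact Hw|].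
    { eapply in_span_trans; [exact Hr|]. apply Hs. now left. }
    exists (r1 ++ r2). split.
    { rewrite length_app in *. simpl in *. lia. }
    intros v Hv. eapply in_span_trans; [|exact (Hr v Hv)].
    intros z Hz. rewrite !in_app_iff in Hz. simpl in Hz.
    destruct (classic (z = r)) as [->|Hzr]; [exact H|].
    apply in_span_In. simpl. rewrite !in_app_iff. intuition congruence.
Qed.

(** * The Hilbert space of square-summable sequences *)


Lemma l2_ex_mult (x y : pt) : l2 x -> l2 y -> ex_series (fun i => x i * y i).
Proof.
  intros Hx Hy.
  apply (ex_series_le (fun i => x i * y i) (fun i => x i ^ 2 + y i ^ 2)).
  - intros n. change (Rabs (x n * y n) <= x n ^ 2 + y n ^ 2).
    apply Rabs_le. split; nra.
  - exact (ex_series_plus _ _ Hx Hy).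
Qed.

Lemma l2_lin (c : R) (x y : pt) : l2 x -> l2 y -> l2 (fun n => c * x n + y n).
Proof.
  intros Hx Hy.
  apply (ex_series_le (fun i => (c * x i + y i) ^ 2) (fun i => 2 * c ^ 2 * x i ^ 2 + 2 * y i ^ 2)).
  - intros n. change (Rabs ((c * x n + y n) ^ 2) <= 2 * c ^ 2 * x n ^ 2 + 2 * y n ^ 2).
    rewrite Rabs_pos_eq by apply pow2_ge_0.
    generalize (pow2_ge_0 (c * x n - y n)). lra.
  - apply (ex_series_plus (fun i => 2 * c ^ 2 * x i ^ 2) (fun i => 2 * y i ^ 2)).
    + exact (ex_series_scal (2 * c ^ 2) _ Hx).
    + exact (ex_series_scal 2 _ Hy).
Qed.

Lemma l2_ext (x y : pt) : l2 x -> (forall n, y n = x n) -> l2 y.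
Proof. intros H E. replace y with x; [exact H|]. extensionality n. now rewrite E. Qed.

Lemma l2_0 : l2 (fun _ => 0).
Proof.
  apply (ex_series_ext (fun n => 0 * (/ 2) ^ n)).
  - intros n. simpl. ring.
  - apply (ex_series_scal 0 (fun n => (/ 2) ^ n)). apply ex_series_geom.
    rewrite Rabs_pos_eq; lra.
Qed.

Lemma l2_sub (x y : pt) : l2 x -> l2 y -> l2 (fun n => x n - y n).
Proof.
  intros Hx Hy. eapply l2_ext; [exact (l2_lin (-1) y x Hy Hx)|]. intros n; simpl; ring.
Qed.

Lemma inner_sym (x y : pt) : inner x y = inner y x.
Proof. apply Series_ext. intros; ring. Qed.

Lemma inner_lin_l (c : R) (x y z : pt) : l2 x -> l2 y -> l2 z ->
  inner (fun n => c * x n + y n) z = c * inner x z + inner y z.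
Proof.
  intros Hx Hy Hz. unfold inner.
  rewrite <- Series_scal_l, <- Series_plus.
  - apply Series_ext. intros; ring.
  - exact (ex_series_scal c _ (l2_ex_mult _ _ Hx Hz)).
  - now apply l2_ex_mult.
Qed.

Lemma inner_lin_r (c : R) (x y z : pt) : l2 x -> l2 y -> l2 z ->
  inner z (fun n => c * x n + y n) = c * inner z x + inner z y.
Proof. intros. rewrite inner_sym, inner_lin_l, (inner_sym x), (inner_sym y); auto. Qed.

Lemma inner_0_l (y : pt) : inner (fun _ => 0) y = 0.
Proof.
  unfold inner. rewrite Series_scal_l. ring.
Qed.

Lemma sum_n_le_Series (a : nat -> R) (n : nat) :
  (forall i, 0 <= a i) -> ex_series a -> sum_n a n <= Series a.
Proof.
  intros Ha H. apply Series_correct in H.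
  apply (is_lim_seq_incr_compare (sum_n a)); [exact H|].
  intros k. rewrite sum_Sn. unfold plus; simpl. specialize (Ha (S k)). lra.
Qed.

Lemma term_le_sum_n (a : nat -> R) (n : nat) : (forall i, 0 <= a i) -> a n <= sum_n a n.
Proof.
  intros Ha. destruct n.
  - rewrite sum_O. lra.
  - rewrite sum_Sn. unfold plus; simpl.
    assert (0 <= sum_n a n); [|lra].
    induction n; [rewrite sum_O; auto|]. rewrite sum_Sn. unfold plus; simpl. specialize (Ha (S n)). lra.
Qed.

Lemma l2_ex_sq (x : pt) : l2 x -> ex_series (fun i => x i * x i).
Proof. intros; now apply l2_ex_mult. Qed.

Lemma coord_sq_le (x : pt) (n : nat) : l2 x -> (x n) ^ 2 <= inner x x.
Proof.
  intros H. apply Rle_trans with (sum_n (fun i => x i * x i) n).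
  - eapply Rle_trans; [|apply term_le_sum_n]; [simpl; lra | intros; nra].
  - apply sum_n_le_Series; [intros; nra | now apply l2_ex_sq].
Qed.

Lemma inner_pos (x : pt) : l2 x -> 0 <= inner x x.
Proof. intros H. eapply Rle_trans; [|apply (coord_sq_le x 0 H)]. nra. Qed.

Lemma inner_eq0 (x : pt) : l2 x -> inner x x = 0 -> forall n, x n = 0.
Proof. intros H E n. generalize (coord_sq_le x n H). rewrite E. nra. Qed.

Lemma cauchy_schwarz (x y : pt) : l2 x -> l2 y -> (inner x y) ^ 2 <= inner x x * inner y y.
Proof.
  intros Hx Hy.
  assert (P : forall t, 0 <= t * t * inner x x + 2 * t * inner x y + inner y y).
  { intros t. generalize (inner_pos _ (l2_lin t x y Hx Hy)).
    rewrite inner_lin_l, !inner_lin_r, (inner_sym y x); auto using l2_lin. lra. }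
  destruct (Req_dec (inner x x) 0) as [E|E].
  - replace (inner x y) with 0; [rewrite E; lra|].
    replace x with (fun _ : nat => 0); [now rewrite inner_0_l|].
    extensionality n. now rewrite (inner_eq0 x).
  - assert (0 < inner x x) by (generalize (inner_pos x Hx); lra).
    (* The minimiser of the quadratic [P]; its value there is the discriminant inequality. *)
    specialize (P (- inner x y / inner x x)).
    apply (Rmult_le_compat_l (inner x x)) in P; [|lra].
    field_simplify in P; lra.
Qed.

Definition norm (x : pt) : R := sqrt (inner x x).

Lemma norm_pos (x : pt) : 0 <= norm x.
Proof. apply sqrt_pos. Qed.

Lemma norm_sq (x : pt) : l2 x -> norm x * norm x = inner x x.
Proof. intros. apply sqrt_sqrt. now apply inner_pos. Qed.

Lemma inner_le_norm (x y : pt) : l2 x -> l2 y -> Rabs (inner x y) <= norm x * norm y.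
Proof.
  intros Hx Hy. unfold norm. rewrite <- sqrt_mult by now apply inner_pos.
  rewrite <- sqrt_Rsqr_abs. apply sqrt_le_1_alt. unfold Rsqr.
  generalize (cauchy_schwarz x y Hx Hy). lra.
Qed.

Lemma norm_lin (c : R) (x y : pt) : l2 x -> l2 y ->
  norm (fun n => c * x n + y n) <= Rabs c * norm x + norm y.
Proof.
  intros Hx Hy. apply Rsqr_incr_0_var.
  - unfold Rsqr. rewrite norm_sq by now apply l2_lin.
    rewrite inner_lin_l, !inner_lin_r, (inner_sym y x), <- !norm_sq; auto using l2_lin.
    generalize (inner_le_norm x y Hx Hy) (norm_pos x) (norm_pos y). intros H1 H2 H3.
    assert (c * inner x y <= Rabs c * (norm x * norm y)).
    { eapply Rle_trans; [apply Rle_abs|]. rewrite Rabs_mult.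
      apply Rmult_le_compat_l; [apply Rabs_pos | exact H1]. }
    assert (Rabs c * Rabs c = c * c) by (rewrite <- Rabs_mult; apply Rabs_pos_eq; nra).
    replace ((Rabs c * norm x + norm y) * (Rabs c * norm x + norm y))
      with ((Rabs c * Rabs c) * (norm x * norm x) + 2 * (Rabs c * (norm x * norm y)) + norm y * norm y) by ring.
    rewrite H0. nra.
  - generalize (norm_pos x) (norm_pos y) (Rabs_pos c). nra.
Qed.

Lemma norm_eq0 (x : pt) : l2 x -> norm x = 0 -> forall n, x n = 0.
Proof. intros H E. apply inner_eq0; [exact H|]. rewrite <- norm_sq, E by exact H. ring. Qed.

Lemma norm_0 : norm (fun _ => 0) = 0.
Proof. unfold norm. rewrite inner_0_l. apply sqrt_0. Qed.

Lemma coord_le_norm (x : pt) (n : nat) : l2 x -> Rabs (x n) <= norm x.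
Proof.
  intros H. rewrite <- sqrt_Rsqr_abs. apply sqrt_le_1_alt. unfold Rsqr.
  generalize (coord_sq_le x n H). lra.
Qed.

Lemma dist_norm (x y : pt) : dist x y = norm (fun n => x n - y n).
Proof. unfold dist, norm, inner. f_equal. apply Series_ext. intros; ring. Qed.

Lemma dist_pos (x y : pt) : 0 <= dist x y.
Proof. apply sqrt_pos. Qed.

Lemma dist_refl (x : pt) : dist x x = 0.
Proof.
  rewrite dist_norm. rewrite <- norm_0. f_equal. extensionality n. ring.
Qed.

Lemma dist_sym (x y : pt) : dist x y = dist y x.
Proof. unfold dist. f_equal. apply Series_ext. intros; ring. Qed.

Lemma dist_tri (x y z : pt) : l2 x -> l2 y -> l2 z -> dist x z <= dist x y + dist y z.
Proof.
  intros Hx Hy Hz. rewrite !dist_norm.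
  generalize (norm_lin 1 _ _ (l2_sub x y Hx Hy) (l2_sub y z Hy Hz)).
  rewrite Rabs_R1, Rmult_1_l.
  replace (fun n => 1 * (x n - y n) + (y n - z n)) with (fun n => x n - z n); [auto|].
  extensionality n. ring.
Qed.

Lemma dist_eq0 (x y : pt) : l2 x -> l2 y -> dist x y = 0 -> x = y.
Proof.
  intros Hx Hy H. rewrite dist_norm in H. extensionality n.
  generalize (norm_eq0 _ (l2_sub x y Hx Hy) H n). lra.
Qed.

Lemma dist_neq (x y : pt) : l2 x -> l2 y -> x <> y -> 0 < dist x y.
Proof.
  intros Hx Hy H. generalize (dist_pos x y). intros [|E]; [assumption|].
  exfalso. apply H. now apply dist_eq0.
Qed.

Lemma l2_span (vs : list pt) (x : pt) : (forall v, In v vs -> l2 v) -> in_span vs x -> l2 x.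
Proof.
  revert x. induction vs as [|v vs IH]; intros x H Hx.
  - rewrite in_span_nil in Hx. eapply l2_ext; [apply l2_0|exact Hx].
  - apply in_span_cons in Hx. destruct Hx as (c & s & Hs & E).
    eapply l2_ext; [|exact E]. apply l2_lin; [apply H; now left|].
    apply IH; [intros; apply H; now right | exact Hs].
Qed.

Lemma inner_span (vs : list pt) (y x : pt) : l2 y -> (forall v, In v vs -> l2 v) ->
  (forall v, In v vs -> inner y v = 0) -> in_span vs x -> inner y x = 0.
Proof.
  intros Hy. revert x. induction vs as [|v vs IH]; intros x H H0 Hx.
  - rewrite in_span_nil in Hx. replace x with (fun _ : nat => 0) by (extensionality n; auto).
    now rewrite inner_sym, inner_0_l.
  - apply in_span_cons in Hx. destruct Hx as (c & s & Hs & E).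
    replace x with (fun n => c * v n + s n) by (extensionality n; auto).
    assert (Hvs : forall v, In v vs -> l2 v) by (intros; apply H; now right).
    rewrite inner_lin_r; [| apply H; now left | eapply l2_span; eauto | exact Hy].
    rewrite (H0 v (or_introl eq_refl)), (IH s); auto; [ring|].
    intros; apply H0; now right.
Qed.

(** Gram-Schmidt, one vector at a time: [w] is the part of [v] orthogonal to the tail, and the
    component along [w] is subtracted. When [w] vanishes, [v] already lies in the span of the tail
    and nothing has to be corrected. *)
Lemma proj_exists (vs : list pt) (x : pt) : (forall v, In v vs -> l2 v) -> l2 x ->
  exists y, l2 y /\ in_span vs (fun n => x n - y n) /\ forall v, In v vs -> inner y v = 0.
Proof.
  intros Hvs. revert x. induction vs as [|v vs IH]; intros x Hx.
  - exists x. split; [exact Hx|]. split; [apply in_span_nil; intros; ring | intros v []].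
  - assert (Hvs' : forall u, In u vs -> l2 u) by (intros; apply Hvs; now right).
    assert (Hv : l2 v) by (apply Hvs; now left).
    destruct (IH Hvs' v Hv) as (w & Hw & Hwv & Hwo).
    destruct (IH Hvs' x Hx) as (y & Hy & Hyx & Hyo).
    assert (incl vs (v :: vs)) as Hincl by (intros z Hz; now right).
    destruct (Req_dec (inner w w) 0) as [E|E].
    + exists y. split; [exact Hy|]. split; [eapply in_span_incl; eauto|].
      intros u [<-|Hu]; [|auto].
      apply (inner_span vs); auto.
      eapply in_span_ext; [exact Hwv|]. intros n. cbv beta. rewrite (inner_eq0 w); auto. ring.
    + exists (fun n => (- inner y w / inner w w) * w n + y n).
      split; [now apply l2_lin|]. split.
      * eapply in_span_ext.
        { apply (in_span_lin _ (inner y w / inner w w) w (fun n => x n - y n)).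
          - apply (in_span_ext _ (fun n => (-1) * (v n - w n) + v n)); [|intros; ring].
            apply in_span_lin; [eapply in_span_incl; eauto | apply in_span_In; now left].
          - eapply in_span_incl; eauto. }
        intros n. simpl. now field.
      * assert (Z : inner (fun n => - inner y w / inner w w * w n + y n) w = 0).
        { rewrite inner_lin_l by auto. now field. }
        assert (Zo : forall u, In u vs -> inner (fun n => - inner y w / inner w w * w n + y n) u = 0).
        { intros u Hu. rewrite inner_lin_l, (Hwo u), (Hyo u) by auto. ring. }
        intros u [<-|Hu]; [|auto].
        replace v with (fun n => 1 * (v n - w n) + w n) by (extensionality n; ring).
        rewrite inner_lin_r; auto using l2_lin, l2_sub.
        rewrite Z, (inner_span vs); auto using l2_lin. ring.
Qed.

Definition abs_sum (cs : list R) : R := fold_right (fun c s => Rabs c + s) 0 cs.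

Lemma abs_sum_pos (cs : list R) : 0 <= abs_sum cs.
Proof. induction cs as [|c cs IH]; simpl; [lra|]. generalize (Rabs_pos c). lra. Qed.

Lemma abs_sum_eq0 (cs : list R) : abs_sum cs <= 0 -> forall c, In c cs -> c = 0.
Proof.
  induction cs as [|c cs IH]; intros H c' Hc; [destruct Hc|]. simpl in H.
  generalize (Rabs_pos c) (abs_sum_pos cs). intros. destruct Hc as [<-|Hc].
  - destruct (Req_dec c 0) as [|N]; [assumption|]. apply Rabs_pos_lt in N. lra.
  - apply IH; [lra|exact Hc].
Qed.

(* Pairing with the component of the head orthogonal to the span of the tail isolates the head's coefficient. *)
Lemma lin_indep_bound (vs : list pt) : (forall v, In v vs -> l2 v) -> lin_indep vs ->
  exists m, 0 < m /\ forall cs, length cs = length vs -> m * abs_sum cs <= norm (lcomb cs vs).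
Proof.
  induction vs as [|v vs IH]; intros Hvs Hi.
  - exists 1. split; [lra|]. intros [|] Hl; [|discriminate]. simpl. rewrite norm_0. lra.
  - assert (Hvs' : forall u, In u vs -> l2 u) by (intros; apply Hvs; now right).
    assert (Hv : l2 v) by (apply Hvs; now left).
    apply lin_indep_cons in Hi. destruct Hi as [Hnv Hi].
    destruct (IH Hvs' Hi) as (m & Hm & Hb).
    destruct (proj_exists vs v Hvs' Hv) as (w & Hw & Hwv & Hwo).
    assert (Hnw : 0 < norm w).
    { destruct (norm_pos w) as [|E]; [assumption|]. exfalso. apply Hnv.
      eapply in_span_ext; [exact Hwv|]. intros n. cbv beta. rewrite (norm_eq0 w); auto. ring. }
    (* The first summand bounds the head's coefficient ([B1]). The second bounds the other
       coefficients: the tail combination has norm at most [1 + norm v / norm w] times the total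
       norm, and [m] is the constant of the tail. *)
    set (K := / norm w + (1 + norm v / norm w) / m).
    assert (Hiw : 0 < / norm w) by now apply Rinv_0_lt_compat.
    assert (Him : 0 < / m) by now apply Rinv_0_lt_compat.
    assert (HK : 0 < K).
    { unfold K, Rdiv. generalize (norm_pos v). intros.
      assert (0 <= norm v * / norm w) by nra. nra. }
    exists (/ K). split; [now apply Rinv_0_lt_compat|].
    intros [|c cs] Hl; [discriminate|]. injection Hl as Hl. simpl.
    set (s := lcomb cs vs). set (z := fun n => c * v n + s n).
    assert (Ss : in_span vs s) by (exists cs; auto).
    assert (Hs : l2 s) by (eapply l2_span; eauto).
    assert (Hz : l2 z) by now apply l2_lin.
    assert (E : inner w z = c * (norm w * norm w)).
    { unfold z. rewrite inner_lin_r, (inner_span vs w s), norm_sq by auto.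
      replace (inner w v) with (inner w (fun n => 1 * (v n - w n) + w n))
        by (f_equal; extensionality n; ring).
      rewrite inner_lin_r by auto using l2_sub.
      rewrite (inner_span vs w (fun n => v n - w n)) by auto. ring. }
    assert (B1 : Rabs c <= norm z * / norm w).
    { apply Rmult_le_reg_r with (norm w * norm w); [nra|].
      replace (norm z * / norm w * (norm w * norm w)) with (norm w * norm z) by (field; lra).
      rewrite <- (Rabs_pos_eq (norm w * norm w)) at 1 by nra.
      rewrite <- Rabs_mult, <- E. now apply inner_le_norm. }
    assert (B2 : norm s <= Rabs c * norm v + norm z).
    { replace s with (fun n => (- c) * v n + z n) by (extensionality n; unfold z; ring).
      rewrite <- (Rabs_Ropp c). now apply norm_lin. }
    assert (B3 : abs_sum cs <= norm s * / m).
    { apply Rmult_le_reg_l with m; [exact Hm|].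
      replace (m * (norm s * / m)) with (norm s) by (field; lra). now apply Hb. }
    apply Rmult_le_reg_l with K; [exact HK|].
    replace (K * (/ K * (Rabs c + abs_sum cs))) with (Rabs c + abs_sum cs) by (field; lra).
    assert (B4 : norm s <= norm z * (1 + norm v * / norm w)).
    { generalize (norm_pos v). intros. nra. }
    assert (norm s * / m <= norm z * (1 + norm v * / norm w) * / m) by nra.
    unfold K, Rdiv. nra.
Qed.

Lemma norm_lcomb_diff (cs : list R) (vs ws : list pt) (d : R) :
  (forall v, In v vs -> l2 v) -> (forall w, In w ws -> l2 w) ->
  length cs = length vs -> Forall2 (fun v w => dist v w <= d) vs ws ->
  norm (fun n => lcomb cs vs n - lcomb cs ws n) <= d * abs_sum cs.
Proof.
  intros Hv Hw Hl H. revert cs Hl. induction H as [|v w vs ws Hd HF IH]; intros [|c cs] Hl; try discriminate.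
  - simpl. replace (fun _ : nat => 0 - 0) with (fun _ : nat => 0) by (extensionality n; ring).
    rewrite norm_0. lra.
  - injection Hl as Hl. simpl.
    assert (Lv : forall u, In u vs -> l2 u) by (intros; apply Hv; now right).
    assert (Lw : forall u, In u ws -> l2 u) by (intros; apply Hw; now right).
    specialize (IH Lv Lw cs Hl).
    replace (fun n => c * v n + lcomb cs vs n - (c * w n + lcomb cs ws n))
      with (fun n => c * (v n - w n) + (lcomb cs vs n - lcomb cs ws n)) by (extensionality n; ring).
    assert (l2 (lcomb cs vs)) by (apply (l2_span vs); auto; exists cs; auto).
    assert (l2 (lcomb cs ws)).
    { apply (l2_span ws); auto. exists cs. split; [|auto]. rewrite Hl. eapply Forall2_length; eauto. }
    assert (l2 v) by (apply Hv; now left). assert (l2 w) by (apply Hw; now left).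
    eapply Rle_trans; [apply norm_lin; apply l2_sub; auto|].
    rewrite dist_norm in Hd. generalize (Rabs_pos c). nra.
Qed.

(** With half of the lower bound [m] as tolerance, a vanishing combination of [ws] gives
    [m * abs_sum cs <= m / 2 * abs_sum cs], so all its coefficients are 0. *)
Lemma lin_indep_open (vs : list pt) : (forall v, In v vs -> l2 v) -> lin_indep vs ->
  exists d, 0 < d /\ forall ws, (forall w, In w ws -> l2 w) ->
    Forall2 (fun v w => dist v w <= d) vs ws -> lin_indep ws.
Proof.
  intros Hvs Hi. destruct (lin_indep_bound vs Hvs Hi) as (m & Hm & Hb).
  exists (m / 2). split; [lra|]. intros ws Hws HF cs Hl E.
  assert (Hl' : length cs = length vs) by (rewrite Hl; symmetry; eapply Forall2_length; eauto).
  generalize (norm_lcomb_diff cs vs ws (m / 2) Hvs Hws Hl' HF) (Hb cs Hl').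
  replace (fun n => lcomb cs vs n - lcomb cs ws n) with (lcomb cs vs)
    by (extensionality n; rewrite E; ring).
  intros H1 H2. apply (abs_sum_eq0 cs). generalize (abs_sum_pos cs). nra.
Qed.

(** * Parametrised Cantor sets *)


Definition agree (n : nat) (a b : nat -> bool) : Prop := forall i, (i < n)%nat -> a i = b i.

(* Initial segments are stored most recent bit first, so that extending one is a [cons]. *)
Fixpoint prefix (a : nat -> bool) (n : nat) : list bool :=
  match n with 0%nat => [] | S n => a n :: prefix a n end.

Lemma prefix_agree (n : nat) (a b : nat -> bool) : prefix a n = prefix b n <-> agree n a b.
Proof.
  induction n as [|n IH]; simpl; split.
  - intros _ i Hi. lia.
  - reflexivity.
  - intros H. injection H as H1 H2. apply IH in H2. intros i Hi.
    destruct (Nat.eq_dec i n) as [->|]; [assumption | apply H2; lia].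
  - intros H. f_equal; [apply H; lia|]. apply IH. intros i Hi. apply H. lia.
Qed.

Lemma length_prefix (a : nat -> bool) (n : nat) : length (prefix a n) = n.
Proof. induction n; simpl; congruence. Qed.

(** Compactness of the Cantor space in the form of bar induction; every uniformity argument below
    goes through it. If the root failed, each failing node would have a failing child, and following
    these would give a branch that never meets [P]. *)
Lemma cantor_induction (P : list bool -> Prop) :
  (forall s, P (true :: s) -> P (false :: s) -> P s) ->
  (forall a, exists n, P (prefix a n)) -> P [].
Proof.
  intros Hstep Hbar. apply NNPP. intros H0.
  set (c := fun s => if excluded_middle_informative (P (true :: s)) then false else true).
  set (path := fix path n := match n with 0%nat => [] | S n => c (path n) :: path n end).
  assert (Hp : forall n, prefix (fun n => c (path n)) n = path n).
  { induction n; simpl; congruence. }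
  assert (Hn : forall n, ~ P (path n)).
  { induction n as [|n IH]; [exact H0|]. simpl. unfold c at 1.
    destruct (excluded_middle_informative (P (true :: path n))) as [Ht|Ht]; auto. }
  destruct (Hbar (fun n => c (path n))) as (n & Hb). rewrite Hp in Hb. exact (Hn n Hb).
Qed.

Definition cterm (a : nat -> bool) (i : nat) : R := if a i then 2 / 3 ^ (S i) else 0.
Definition cval (a : nat -> bool) : R := Series (cterm a).

Lemma pow3_pos (n : nat) : 0 < 3 ^ n.
Proof. apply pow_lt. lra. Qed.

Lemma cterm_bounds (a : nat -> bool) (i : nat) : 0 <= cterm a i <= 2 / 3 * (1 / 3) ^ i.
Proof.
  assert (2 / 3 ^ (S i) = 2 / 3 * (1 / 3) ^ i).
  { unfold Rdiv. rewrite Rpow_mult_distr, pow1, pow_inv. simpl. generalize (pow3_pos i). intros. field. lra. }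
  assert (0 < (1 / 3) ^ i) by (apply pow_lt; lra).
  unfold cterm. destruct (a i); rewrite ?H; nra.
Qed.

Lemma ex_series_geom3 : ex_series (fun i => 2 / 3 * (1 / 3) ^ i).
Proof.
  apply (ex_series_scal (2 / 3) (fun i => (1 / 3) ^ i)).
  apply ex_series_geom. rewrite Rabs_pos_eq; lra.
Qed.

Lemma ex_series_cterm (a : nat -> bool) : ex_series (cterm a).
Proof.
  apply (ex_series_le (cterm a) _) with (2 := ex_series_geom3).
  intros n. change (Rabs (cterm a n) <= 2 / 3 * (1 / 3) ^ n).
  generalize (cterm_bounds a n). intros. rewrite Rabs_pos_eq; lra.
Qed.

Lemma cval_bounds (a : nat -> bool) : 0 <= cval a <= 1.
Proof.
  split.
  - generalize (sum_n_le_Series (cterm a) 0 (fun i => proj1 (cterm_bounds a i)) (ex_series_cterm a)).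
    rewrite sum_O. generalize (cterm_bounds a 0). unfold cval. lra.
  - apply Rle_trans with (Series (fun i => 2 / 3 * (1 / 3) ^ i)).
    + apply Series_le; [apply cterm_bounds | apply ex_series_geom3].
    + rewrite Series_scal_l, Series_geom; [lra|]. rewrite Rabs_pos_eq; lra.
Qed.

Lemma cval_shift (a : nat -> bool) :
  cval a = (if a 0%nat then 2 / 3 else 0) + / 3 * cval (fun i => a (S i)).
Proof.
  unfold cval. rewrite Series_incr_1 by apply ex_series_cterm. f_equal.
  - unfold cterm. simpl. destruct (a 0%nat); [field|reflexivity].
  - rewrite <- Series_scal_l. apply Series_ext. intros n. unfold cterm.
    destruct (a (S n)); [|ring]. simpl. generalize (pow3_pos n). intros. field. lra.
Qed.

Lemma agree_shift (n : nat) (a b : nat -> bool) :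
  agree (S n) a b <-> a 0%nat = b 0%nat /\ agree n (fun i => a (S i)) (fun i => b (S i)).
Proof.
  split.
  - intros H. split; [apply H; lia|]. intros i Hi. apply H. lia.
  - intros [H0 H] [|i] Hi; [exact H0|]. apply H. lia.
Qed.

Lemma cval_agree (n : nat) (a b : nat -> bool) : agree n a b -> Rabs (cval a - cval b) <= / 3 ^ n.
Proof.
  revert a b. induction n as [|n IH]; intros a b H.
  - simpl. generalize (cval_bounds a) (cval_bounds b). intros. apply Rabs_le. lra.
  - apply agree_shift in H. destruct H as [H0 H]. specialize (IH _ _ H).
    rewrite (cval_shift a), (cval_shift b), H0. simpl. rewrite Rinv_mult.
    match goal with |- Rabs ?x <= _ => replace x with
      (/ 3 * (cval (fun i => a (S i)) - cval (fun i => b (S i)))) by ring end.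
    rewrite Rabs_mult, Rabs_pos_eq by lra. lra.
Qed.

(** Different first digits contribute 2/3, of which the tails can cancel at most 1/3; equal first
    digits reduce to the shifted sequences at scale 1/3. With [cval_agree] this identifies closeness
    in the middle-thirds set with agreement of prefixes. *)
Lemma cval_disagree (n : nat) (a b : nat -> bool) :
  ~ agree n a b -> / 3 ^ n <= Rabs (cval a - cval b).
Proof.
  revert a b. induction n as [|n IH]; intros a b H.
  - exfalso. apply H. intros i Hi. lia.
  - rewrite (cval_shift a), (cval_shift b). simpl. rewrite Rinv_mult.
    assert (0 < / 3 ^ n <= 1).
    { split; [apply Rinv_0_lt_compat, pow3_pos|]. rewrite <- Rinv_1.
      apply Rinv_le_contravar; [lra|]. apply pow_R1_Rle. lra. }
    generalize (cval_bounds (fun i => a (S i))) (cval_bounds (fun i => b (S i))). intros.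
    destruct (Bool.bool_dec (a 0%nat) (b 0%nat)) as [E|E].
    + assert (Hs : ~ agree n (fun i => a (S i)) (fun i => b (S i))).
      { intros Hs. apply H, agree_shift. auto. }
      specialize (IH _ _ Hs). rewrite E.
      match goal with |- _ <= Rabs ?x => replace x with
        (/ 3 * (cval (fun i => a (S i)) - cval (fun i => b (S i)))) by ring end.
      rewrite Rabs_mult, (Rabs_pos_eq (/ 3)) by lra. lra.
    + destruct (a 0%nat), (b 0%nat); try congruence.
      * eapply Rle_trans; [|apply Rle_abs]. lra.
      * rewrite Rabs_minus_sym. eapply Rle_trans; [|apply Rle_abs]. lra.
Qed.

Lemma pow3_small (eps : R) : 0 < eps -> exists n, / 3 ^ n < eps.
Proof.
  intros H. destruct (pow_lt_1_zero (/ 3)) with (y := eps) as (n & Hn); [rewrite Rabs_pos_eq; lra|exact H|].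
  exists n. specialize (Hn n (le_n n)). rewrite pow_inv in Hn.
  eapply Rle_lt_trans; [apply Rle_abs|exact Hn].
Qed.

Lemma cval_inj (a b : nat -> bool) : cval a = cval b -> a = b.
Proof.
  intros H. extensionality i. apply NNPP. intros N.
  assert (D : ~ agree (S i) a b) by (intros D; apply N, D; lia).
  apply cval_disagree in D. rewrite H, Rminus_diag, Rabs_R0 in D.
  generalize (Rinv_0_lt_compat _ (pow3_pos (S i))). lra.
Qed.

Lemma middle_thirds_cval (t : R) : middle_thirds t <-> exists a, cval a = t.
Proof.
  split; intros (a & H); exists a.
  - now apply is_series_unique.
  - rewrite <- H. apply Series_correct, ex_series_cterm.
Qed.

(** A Cantor set as a continuous bijective image of the bit sequences, continuity being phrased
    through prefixes so that [cantor_induction] applies directly. Continuity of the inverse is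
    derived from compactness in [cantor_param_inverse]. *)
Definition cantor_param (M : pt -> Prop) (G : (nat -> bool) -> pt) : Prop :=
  (forall a, M (G a)) /\ (forall x, M x -> exists a, G a = x) /\
  (forall a b, G a = G b -> a = b) /\
  (forall a eps, 0 < eps -> exists n, forall b, agree n a b -> dist (G b) (G a) < eps).

Lemma is_cantor_param (E M : pt -> Prop) : is_cantor E M -> exists G, cantor_param M G.
Proof.
  intros (HE & f & g & Hf & Hg & Cf & Cg).
  assert (mt : forall a, middle_thirds (cval a)) by (intros a; apply middle_thirds_cval; now exists a).
  exists (fun a => g (cval a)). split; [|split; [|split]].
  - intros a. now apply Hg.
  - intros x Hx. destruct (Hf x Hx) as [H1 H2]. apply middle_thirds_cval in H1.
    destruct H1 as (a & Ha). exists a. now rewrite Ha.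
  - intros a b H. apply cval_inj.
    destruct (Hg _ (mt a)) as [_ <-]. destruct (Hg _ (mt b)) as [_ <-]. now rewrite H.
  - intros a eps Heps. destruct (Cg _ (mt a) eps Heps) as (d & Hd & H).
    destruct (pow3_small d Hd) as (n & Hn). exists n. intros b Hb.
    apply H; [apply mt|]. rewrite Rabs_minus_sym.
    eapply Rle_lt_trans; [apply cval_agree, Hb | exact Hn].
Qed.

(** A continuous injection of a compact space is a homeomorphism onto its image: the points whose
    sequences leave [a] before level [n] form a compact set that misses [G a], hence stay at a
    positive distance from it. *)
Lemma cantor_param_inverse (M : pt -> Prop) (G : (nat -> bool) -> pt) :
  (forall x, M x -> l2 x) -> cantor_param M G -> forall a n, exists d, 0 < d /\
  forall b, dist (G a) (G b) < d -> agree n a b.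
Proof.
  intros HM (GM & _ & Gi & Gc) a n.
  enough (exists d, 0 < d /\ forall b, prefix b 0 = [] -> ~ agree n a b -> d <= dist (G a) (G b))
    as (d & Hd & H).
  { exists d. split; [exact Hd|]. intros b Hb. apply NNPP. intros N.
    specialize (H b eq_refl N). lra. }
  change 0%nat with (length (@nil bool)).
  apply (cantor_induction (fun s => exists d, 0 < d /\
    forall b, prefix b (length s) = s -> ~ agree n a b -> d <= dist (G a) (G b))).
  - intros s (d1 & H1 & D1) (d2 & H2 & D2). exists (Rmin d1 d2).
    split; [now apply Rmin_pos|]. intros b Hb Nb.
    destruct (b (length s)) eqn:E.
    + eapply Rle_trans; [apply Rmin_l|]. apply D1; [simpl; congruence|exact Nb].
    + eapply Rle_trans; [apply Rmin_r|]. apply D2; [simpl; congruence|exact Nb].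
  - intros b. destruct (classic (agree n a b)) as [Hb|Hb].
    (* Every sequence through this node agrees with [a] up to [n], so the claim is vacuous and 1 is
       arbitrary. *)
    + exists n. exists 1. split; [lra|]. intros c Hc Nc. exfalso. apply Nc.
      rewrite length_prefix in Hc. apply prefix_agree in Hc.
      intros i Hi. rewrite Hb by exact Hi. symmetry. now apply Hc.
    + assert (P : 0 < dist (G a) (G b)).
      { apply dist_neq; auto. intros E. apply Hb. apply Gi in E. subst. intros i Hi; reflexivity. }
      destruct (Gc b (dist (G a) (G b) / 2)) as (m & Hm); [lra|].
      exists m, (dist (G a) (G b) / 2). split; [lra|]. intros c Hc _.
      rewrite length_prefix in Hc. apply prefix_agree in Hc.
      assert (Hbc : agree m b c) by (intros i Hi; symmetry; now apply Hc).
      specialize (Hm c Hbc).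
      generalize (dist_tri (G a) (G c) (G b) (HM _ (GM a)) (HM _ (GM c)) (HM _ (GM b))). lra.
Qed.

Lemma is_cantor_of_param (E M : pt -> Prop) (G : (nat -> bool) -> pt) :
  (forall x, M x -> E x) -> (forall x, E x -> l2 x) -> cantor_param M G -> is_cantor E M.
Proof.
  intros HME HE HG. assert (Hinv := cantor_param_inverse M G (fun x Hx => HE x (HME x Hx)) HG).
  destruct HG as (GM & Gs & Gi & Gc).
  split; [exact HME|].
  assert (Cf : exists c : pt -> nat -> bool, forall x, M x -> G (c x) = x).
  { apply (functional_choice (fun x a => M x -> G a = x)). intros x.
    destruct (classic (M x)) as [Hx|Hx]; [destruct (Gs x Hx) as (a & Ha); now exists a|].
    exists (fun _ => true). tauto. }
  assert (Cg : exists c : R -> nat -> bool, forall t, middle_thirds t -> cval (c t) = t).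
  { apply (functional_choice (fun t a => middle_thirds t -> cval a = t)). intros t.
    destruct (classic (middle_thirds t)) as [Ht|Ht].
    - apply middle_thirds_cval in Ht. destruct Ht as (a & Ha). now exists a.
    - exists (fun _ => true). tauto. }
  destruct Cf as (cf & Hcf). destruct Cg as (cg & Hcg).
  assert (mt : forall a, middle_thirds (cval a)) by (intros a; apply middle_thirds_cval; now exists a).
  assert (Kf : forall a, cf (G a) = a) by (intros a; apply Gi; apply Hcf, GM).
  assert (Kg : forall a, cg (cval a) = a) by (intros a; apply cval_inj; apply Hcg, mt).
  exists (fun x => cval (cf x)), (fun t => G (cg t)).
  split; [|split; [|split]].
  - intros x Hx. split; [apply mt|]. rewrite Kg. now apply Hcf.
  - intros t Ht. split; [apply GM|]. rewrite Kf. now apply Hcg.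
  - intros x Hx eps Heps. destruct (pow3_small eps Heps) as (n & Hn).
    destruct (Hinv (cf x) n) as (d & Hd & H). exists d. split; [exact Hd|].
    intros y Hy Hxy. eapply Rle_lt_trans; [|exact Hn].
    rewrite Rabs_minus_sym. apply cval_agree, H. now rewrite !Hcf.
  - intros t Ht eps Heps. destruct (Gc (cg t) eps Heps) as (n & Hn).
    exists (/ 3 ^ n). split; [apply Rinv_0_lt_compat, pow3_pos|].
    intros s Hs Hst. apply Hn. apply NNPP. intros N. apply cval_disagree in N.
    rewrite !Hcg, Rabs_minus_sym in N by assumption. lra.
Qed.

(** * Compactness and openness *)


(** [real] sends infinite values to 0, so finiteness of the infimum has to come first: a point of
    [B] excludes plus infinity, and non-negativity of distances excludes minus infinity. *)
Lemma dist_to_spec (B : pt -> Prop) (a : pt) : (exists b, B b) ->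
  0 <= dist_to B a /\ (forall b, B b -> dist_to B a <= dist a b) /\
  (forall e, dist_to B a < e -> exists b, B b /\ dist a b < e).
Proof.
  intros (b0 & Hb0). unfold dist_to.
  destruct (Glb_Rbar_correct (fun s => exists b, B b /\ s = dist a b)) as [Hl Hg].
  set (g := Glb_Rbar _) in *.
  assert (H0 : Rbar_le 0 g).
  { apply Hg. intros x (b & _ & ->). apply dist_pos. }
  assert (H1 : forall b, B b -> Rbar_le g (dist a b)) by (intros b Hb; apply Hl; eauto).
  destruct g as [g| |]; simpl in *; [|destruct (H1 b0 Hb0)|destruct H0].
  split; [exact H0|]. split; [exact H1|]. intros e He.
  apply NNPP. intros N. assert (e <= g); [|lra].
  apply (Hg e). intros x (b & Hb & ->). simpl.
  apply Rnot_lt_le. intros Hlt. apply N. eauto.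
Qed.

Lemma exc_le (A B : pt -> Prop) (e : R) : (exists a, A a) ->
  (forall a, A a -> dist_to B a <= e) -> exc A B <= e.
Proof.
  intros (a & Ha) H. unfold exc.
  destruct (Lub_Rbar_correct (fun r => exists a, A a /\ r = dist_to B a)) as [Hu Hl].
  set (g := Lub_Rbar _) in *.
  assert (H1 : Rbar_le g e) by (apply Hl; intros x (b & Hb & ->); now apply H).
  assert (H2 : Rbar_le (dist_to B a) g) by (apply Hu; eauto).
  destruct g; simpl in *; tauto.
Qed.

(** The uniform bound [C] keeps the supremum finite; an infinite one would be turned into 0 by
    [real]. *)
Lemma dist_to_le_exc (A B : pt -> Prop) (C : R) (a : pt) :
  (forall a, A a -> dist_to B a <= C) -> A a -> dist_to B a <= exc A B.
Proof.
  intros H Ha. unfold exc.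
  destruct (Lub_Rbar_correct (fun r => exists a, A a /\ r = dist_to B a)) as [Hu Hl].
  set (g := Lub_Rbar _) in *.
  assert (H1 : Rbar_le g C) by (apply Hl; intros x (b & Hb & ->); now apply H).
  assert (H2 : Rbar_le (dist_to B a) g) by (apply Hu; eauto).
  destruct g; simpl in *; tauto.
Qed.

(** Read from the end of the list, every edge attaches a new vertex [b], so no cycle can arise.
    [apart] is a parameter because the same shape is used with plain distinctness and with a
    quantitative gap, and [V] because vertices may be points, words or bit sequences. *)
Fixpoint forest {V : Type} (apart : V -> V -> Prop) (F : list (V * V)) : Prop :=
  match F with
  | [] => True
  | (a, b) :: F' => apart b a /\ (forall e, In e F' -> apart b (fst e) /\ apart b (snd e)) /\
                    forest apart F'
  end.

Definition on_vertices {V : Type} (P : V -> Prop) (F : list (V * V)) : Prop :=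
  forall e, In e F -> P (fst e) /\ P (snd e).

Definition diffs (F : list (pt * pt)) : list pt := map (fun e n => snd e n - fst e n) F.

Lemma length_diffs (F : list (pt * pt)) : length (diffs F) = length F.
Proof. apply length_map. Qed.

Definition close (d : R) (e e' : pt * pt) : Prop :=
  dist (fst e) (fst e') < d /\ dist (snd e) (snd e') < d.

(* [D e]: forests with [e] edges are required to be independent; [e <= N] in R^N, any [e] in l2. *)
Record ambient (E : pt -> Prop) (D : nat -> Prop) : Prop := {
  amb_l2 : forall x, E x -> l2 x;
  amb_zero : E (fun _ => 0);
  amb_lin : forall c x y, E x -> E y -> E (fun n => c * x n + y n);
  amb_closed : forall x, l2 x -> (forall eps, 0 < eps -> exists y, E y /\ dist y x < eps) -> E x;
  amb_le : forall m n, (m <= n)%nat -> D n -> D m;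
  amb_room : forall vs, D (S (length vs)) -> exists x, E x /\ ~ in_span vs x }.

Definition general (D : nat -> Prop) (M : pt -> Prop) : Prop :=
  forall F, on_vertices M F -> forest (fun x y => x <> y) F -> D (length F) ->
    lin_indep (diffs F).

Definition near (E K : pt -> Prop) (d : R) (y : pt) : Prop :=
  E y /\ exists x, K x /\ dist x y < d.

(** Independence is demanded on a whole neighbourhood of [K]. Openness then only costs halving [d],
    and compactness is confined to the proof that general sets are robust. *)
Definition robust (E : pt -> Prop) (D : nat -> Prop) (n : nat) (K : pt -> Prop) : Prop :=
  exists d, 0 < d /\ forall F, on_vertices (near E K d) F ->
    forest (fun x y => / INR (S n) <= dist x y) F -> (length F <= n)%nat -> D (length F) ->
    lin_indep (diffs F).

Lemma on_vertices_cons {V : Type} (P : V -> Prop) (a b : V) (F : list (V * V)) :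
  on_vertices P ((a, b) :: F) <-> P a /\ P b /\ on_vertices P F.
Proof.
  split.
  - intros H. destruct (H (a, b) (or_introl eq_refl)). repeat split; auto; apply H; now right.
  - intros (Ha & Hb & H) e [<-|He]; [split; assumption|auto].
Qed.

Definition map_edges {V W : Type} (f : V -> W) (F : list (V * V)) : list (W * W) :=
  map (fun e => (f (fst e), f (snd e))) F.

Lemma forest_map {V W : Type} (f : V -> W) (P : V -> Prop) (R1 : V -> V -> Prop)
  (R2 : W -> W -> Prop) (F : list (V * V)) :
  (forall x y, P x -> P y -> R1 x y -> R2 (f x) (f y)) -> on_vertices P F -> forest R1 F ->
  forest R2 (map_edges f F).
Proof.
  intros H. induction F as [|(a, b) F IH]; simpl; [auto|].
  intros HP (H1 & H2 & H3). apply on_vertices_cons in HP. destruct HP as (Pa & Pb & HP).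
  split; [auto|]. split; [|auto].
  intros e He. apply in_map_iff in He. destruct He as (e' & <- & He'). simpl.
  destruct (H2 e' He'), (HP e' He'). auto.
Qed.

Lemma map_edges_id {V : Type} (F : list (V * V)) : map_edges (fun v => v) F = F.
Proof. rewrite <- (map_id F) at 2. apply map_ext. now intros []. Qed.

Lemma forest_skipn {V : Type} (apart : V -> V -> Prop) (F : list (V * V)) (n : nat) :
  forest apart F -> forest apart (skipn n F).
Proof.
  revert n. induction F as [|(a, b) F IH]; intros [|n] H; try exact H.
  simpl. apply IH. apply H.
Qed.

Section Ambient.
Variables (E : pt -> Prop) (D : nat -> Prop).
Hypothesis amb : ambient E D.

Lemma diffs_l2 (F : list (pt * pt)) : on_vertices E F -> forall v, In v (diffs F) -> l2 v.
Proof.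
  intros H v Hv. apply in_map_iff in Hv. destruct Hv as (e & <- & He).
  destruct (H e He). apply l2_sub; eapply amb_l2; eauto.
Qed.

Lemma diffs_close (F F' : list (pt * pt)) (d : R) : on_vertices E F -> on_vertices E F' ->
  Forall2 (close (d / 2)) F F' -> Forall2 (fun v w => dist v w <= d) (diffs F) (diffs F').
Proof.
  intros H H' HF. induction HF as [|(a, b) (a', b') F F' [Ha Hb] HF IH]; simpl; constructor.
  - apply on_vertices_cons in H. apply on_vertices_cons in H'.
    destruct H as (Ea & Eb & _). destruct H' as (Ea' & Eb' & _). simpl in *.
    apply (amb_l2 _ _ amb) in Ea, Eb, Ea', Eb'.
    rewrite dist_norm in *.
    generalize (norm_lin (-1) _ _ (l2_sub a a' Ea Ea') (l2_sub b b' Eb Eb')).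
    rewrite Rabs_left by lra.
    replace (fun n => -1 * (a n - a' n) + (b n - b' n)) with
      (fun n => b n - a n - (b' n - a' n)) by (extensionality n; ring).
    lra.
  - apply IH; intros e He; [apply H | apply H']; now right.
Qed.

Lemma forest_open (F : list (pt * pt)) : on_vertices E F -> lin_indep (diffs F) ->
  exists d, 0 < d /\ forall F', on_vertices E F' -> Forall2 (close d) F F' -> lin_indep (diffs F').
Proof.
  intros H Hi. destruct (lin_indep_open _ (diffs_l2 F H) Hi) as (d & Hd & Ho).
  exists (d / 2). split; [lra|]. intros F' H' HF. apply Ho; [now apply diffs_l2|].
  now apply diffs_close.
Qed.

(** A Lebesgue number argument: radii valid locally are replaced by one valid near all of [K]. [Phi]
    depends on the radius as well, so that conditions on further points at the same scale can be put
    inside it and the lemma can be iterated. *)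
Lemma cantor_compact (K : pt -> Prop) (G : (nat -> bool) -> pt) (Phi : R -> pt -> Prop) :
  (forall x, K x -> E x) -> cantor_param K G ->
  (forall d d' y, d' <= d -> Phi d y -> Phi d' y) ->
  (forall x, K x -> exists d, 0 < d /\ forall y, E y -> dist x y < d -> Phi d y) ->
  exists d, 0 < d /\ forall y, near E K d y -> Phi d y.
Proof.
  intros HK (GK & Gs & _ & Gc) anti H.
  enough (exists d, 0 < d /\ forall a, prefix a (length (@nil bool)) = [] ->
    forall y, E y -> dist (G a) y < d -> Phi d y) as (d & Hd & P).
  { exists d. split; [exact Hd|]. intros y (Ey & x & Kx & Hxy).
    destruct (Gs x Kx) as (a & <-). now apply (P a). }
  apply (cantor_induction (fun s => exists d, 0 < d /\ forall a, prefix a (length s) = s ->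
    forall y, E y -> dist (G a) y < d -> Phi d y)).
  - intros s (d1 & H1 & P1) (d2 & H2 & P2). exists (Rmin d1 d2).
    split; [now apply Rmin_pos|]. intros a Ha y Ey Hy.
    generalize (Rmin_l d1 d2) (Rmin_r d1 d2). intros L1 L2.
    destruct (a (length s)) eqn:Ea.
    + apply (anti d1); [exact L1|]. apply (P1 a); [simpl; congruence|exact Ey|lra].
    + apply (anti d2); [exact L2|]. apply (P2 a); [simpl; congruence|exact Ey|lra].
  - intros a. destruct (H (G a) (GK a)) as (d & Hd & P).
    (* Half of the radius is spent on the move from [G a] to [G b], the other half on the distance
       from [G b] to [y]. *)
    destruct (Gc a (d / 2)) as (n & Hn); [lra|].
    exists n, (d / 2). split; [lra|]. intros b Hb y Ey Hy.
    rewrite length_prefix in Hb. apply prefix_agree in Hb.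
    apply (anti d); [lra|]. apply P; [exact Ey|].
    assert (Hab : agree n a b) by (intros i Hi; symmetry; now apply Hb).
    specialize (Hn b Hab). rewrite dist_sym in Hn.
    generalize (dist_tri (G a) (G b) y (amb_l2 _ _ amb _ (HK _ (GK a)))
      (amb_l2 _ _ amb _ (HK _ (GK b))) (amb_l2 _ _ amb _ Ey)). lra.
Qed.

(** Compactness of the 2m-fold power of [K]. The two ends of the first edge are handled by two uses
    of [cantor_compact], the other edges by induction; points already fixed reappear as conditions
    such as [dist x x' < d] within [Phi]. *)
Lemma forest_compact (K : pt -> Prop) (G : (nat -> bool) -> pt) (m : nat)
  (Phi : R -> list (pt * pt) -> Prop) :
  (forall x, K x -> E x) -> cantor_param K G ->
  (forall d d' F, d' <= d -> Phi d F -> Phi d' F) ->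
  (forall F, length F = m -> on_vertices K F -> exists d, 0 < d /\
     forall F', on_vertices E F' -> Forall2 (close d) F F' -> Phi d F') ->
  exists d, 0 < d /\ forall F, length F = m -> on_vertices (near E K d) F -> Phi d F.
Proof.
  intros HK HG. revert Phi. induction m as [|m IH]; intros Phi anti H.
  - destruct (H [] eq_refl) as (d & Hd & P); [intros e []|].
    exists d. split; [exact Hd|]. intros [|] Hl _; [|discriminate]. apply P; [intros e []|constructor].
  - enough (exists d, 0 < d /\ forall x, near E K d x -> forall y, near E K d y ->
      forall F, length F = m -> on_vertices (near E K d) F -> Phi d ((x, y) :: F)) as (d & Hd & P).
    { exists d. split; [exact Hd|]. intros [|(x, y) F] Hl HF; [discriminate|].
      apply on_vertices_cons in HF. apply P; try tauto. now injection Hl. }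
    assert (mono : forall d d' x, d' <= d -> near E K d' x -> near E K d x).
    { intros d d' x Hd (Ex & z & Kz & Hz). split; [exact Ex|]. exists z. split; [exact Kz|lra]. }
    assert (mono' : forall d d' F, d' <= d -> on_vertices (near E K d') F -> on_vertices (near E K d) F).
    { intros d d' F Hd HF e He. destruct (HF e He). split; eapply mono; eauto. }
    apply (cantor_compact K G (fun d x => forall y, near E K d y ->
      forall F, length F = m -> on_vertices (near E K d) F -> Phi d ((x, y) :: F)) HK HG).
    { intros d d' x Hd P y Hy F Hl HF. apply (anti d); [exact Hd|]. apply P; eauto. }
    intros x Kx.
    destruct (cantor_compact K G (fun d y => forall x', E x' -> dist x x' < d ->
      forall F, length F = m -> on_vertices (near E K d) F -> Phi d ((x', y) :: F)) HK HG)
      as (d & Hd & P).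
    + intros d d' y Hd P x' Ex' Hx' F Hl HF. apply (anti d); [exact Hd|]. apply P; eauto. lra.
    + intros y Ky.
      destruct (IH (fun d F => forall x', E x' -> dist x x' < d -> forall y', E y' ->
        dist y y' < d -> Phi d ((x', y') :: F))) as (d & Hd & P).
      * intros d d' F Hd P x' Ex' Hx' y' Ey' Hy'. apply (anti d); [exact Hd|].
        apply P; auto; lra.
      * intros F Hl HF.
        destruct (H ((x, y) :: F)) as (d & Hd & P); [simpl; congruence|now apply on_vertices_cons|].
        exists d. split; [exact Hd|]. intros F' HF' Hc x' Ex' Hx' y' Ey' Hy'.
        apply P; [now apply on_vertices_cons|]. constructor; [now split|exact Hc].
      * exists d. split; [exact Hd|]. intros y' Ey' Hy' x' Ex' Hx' F Hl HF.
        apply P; auto.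
    + exists d. split; [exact Hd|]. intros x' Ex' Hx' y Hy F Hl HF. apply P; auto.
Qed.

Lemma uniform_up_to (P : nat -> R -> Prop) :
  (forall m d d', d' <= d -> P m d -> P m d') -> (forall m, exists d, 0 < d /\ P m d) ->
  forall n, exists d, 0 < d /\ forall m, (m <= n)%nat -> P m d.
Proof.
  intros anti H. induction n as [|n (d & Hd & IH)].
  - destruct (H 0%nat) as (d & Hd & P0). exists d. split; [exact Hd|].
    intros m Hm. now replace m with 0%nat by lia.
  - destruct (H (S n)) as (d' & Hd' & P'). exists (Rmin d d'). split; [now apply Rmin_pos|].
    intros m Hm. destruct (Nat.eq_dec m (S n)) as [->|].
    + apply (anti _ d'); [apply Rmin_r|exact P'].
    + apply (anti _ d); [apply Rmin_l|]. apply IH. lia.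
Qed.

(** This is why a gap survives limits: were two vertices of [F] that must differ equal, their
    counterparts in [F'] would both lie within [s / 2] of the common point, hence closer than [s] to
    each other. *)
Lemma forest_of_close (s : R) (F F' : list (pt * pt)) : 0 < s ->
  on_vertices E F -> on_vertices E F' -> Forall2 (close (s / 2)) F F' ->
  forest (fun x y => s <= dist x y) F' -> forest (fun x y => x <> y) F.
Proof.
  intros Hs HE HE' HF.
  assert (K : forall x x' y', l2 x -> l2 x' -> l2 y' -> dist x x' < s / 2 -> dist x y' < s / 2 ->
    s <= dist x' y' -> False).
  { intros x x' y' Lx Lx' Ly' H1 H2 H3. generalize (dist_tri x' x y' Lx' Lx Ly').
    rewrite (dist_sym x' x). lra. }
  induction HF as [|(a, b) (a', b') F F' [Ha Hb] HF IH]; simpl; [auto|].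
  apply on_vertices_cons in HE. apply on_vertices_cons in HE'.
  destruct HE as (Ea & Eb & HE). destruct HE' as (Ea' & Eb' & HE').
  intros (H1 & H2 & H3). simpl in *.
  apply (amb_l2 _ _ amb) in Ea, Eb, Ea', Eb'.
  split; [intros ->; eauto|]. split; [|auto].
  clear IH H3. induction HF as [|(c, e) (c', e') F F' [Hc He] HF IH]; intros w [].
  - subst w. destruct (H2 _ (or_introl eq_refl)). simpl in *.
    apply on_vertices_cons in HE. apply on_vertices_cons in HE'.
    destruct HE as (Ec & Ee & _). destruct HE' as (Ec' & Ee' & _).
    apply (amb_l2 _ _ amb) in Ec, Ee, Ec', Ee'.
    split; intros ->; eauto.
  - apply on_vertices_cons in HE. apply on_vertices_cons in HE'.
    apply IH; try tauto. intros z Hz. apply H2. now right.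
Qed.

Lemma general_robust (K : pt -> Prop) (n : nat) : is_cantor E K -> general D K -> robust E D n K.
Proof.
  intros HK Hg. destruct (is_cantor_param E K HK) as (G & HG). destruct HK as [HK _].
  set (s := / INR (S n)).
  assert (Hs : 0 < s) by (apply Rinv_0_lt_compat, lt_0_INR; lia).
  destruct (uniform_up_to (fun m d => forall F, length F = m -> on_vertices (near E K d) F ->
    forest (fun x y => s <= dist x y) F -> D (length F) -> lin_indep (diffs F))) with (n := n)
    as (d & Hd & P).
  - intros m d d' Hd P F Hl HF. apply P; [exact Hl|]. intros e He.
    destruct (HF e He) as [(E1 & x & Kx & Hx) (E2 & y & Ky & Hy)].
    split; (split; [assumption|]); [exists x | exists y]; (split; [assumption|lra]).
  - intros m.
    apply (forest_compact K G m (fun _ F => forest (fun x y => s <= dist x y) F ->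
      D (length F) -> lin_indep (diffs F)) HK HG).
    + auto.
    + intros F Hl HF.
      assert (HEF : on_vertices E F) by (intros e He; destruct (HF e He); auto).
      (* Around a genuine forest of admissible length, openness of independence gives the radius.
         Otherwise the requirement is vacuous nearby: either the length is excluded, or by
         [forest_of_close] no list near [F] has the gap [s]. *)
      destruct (classic (forest (fun x y => x <> y) F)) as [Hf|Hf].
      * destruct (classic (D (length F))) as [HD|HD].
        { destruct (forest_open F HEF (Hg F HF Hf HD)) as (d & Hd & P).
          exists d. split; [exact Hd|]. intros F' HF' Hc _ _. now apply P. }
        exists 1. split; [lra|]. intros F' _ Hc _ HD'. exfalso. apply HD.
        now rewrite (Forall2_length Hc).
      * exists (s / 2). split; [lra|]. intros F' HF' Hc Hsep _. exfalso. apply Hf.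
        eapply forest_of_close; eauto.
  - exists d. split; [exact Hd|]. intros F HF Hsep Hl HD. eapply P; eauto.
Qed.

Lemma forest_separation (F : list (pt * pt)) : on_vertices E F -> forest (fun x y => x <> y) F ->
  exists s, 0 < s /\ forest (fun x y => s <= dist x y) F.
Proof.
  assert (weaken : forall s s' F, s' <= s -> forest (fun x y => s <= dist x y) F ->
    forest (fun x y => s' <= dist x y) F).
  { intros s s' F0 Hs. induction F0 as [|(a, b) F0 IH]; simpl; [auto|].
    intros (H1 & H2 & H3). split; [lra|]. split; [|auto].
    intros e He. destruct (H2 e He). split; lra. }
  induction F as [|(a, b) F IH]; simpl; intros HE.
  - exists 1. split; [lra|exact I].
  - apply on_vertices_cons in HE. destruct HE as (Ea & Eb & HE). intros (H1 & H2 & H3).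
    destruct (IH HE H3) as (s & Hs & HF).
    assert (dp : forall x, E x -> b <> x -> 0 < dist b x).
    { intros x Ex N. apply dist_neq; auto; eapply amb_l2; eauto. }
    assert (exists s', 0 < s' /\ forall e, In e F -> s' <= dist b (fst e) /\ s' <= dist b (snd e))
      as (s' & Hs' & HF').
    { clear - H2 HE dp. induction F as [|(c, e) F IH].
      - exists 1. split; [lra|intros e []].
      - apply on_vertices_cons in HE. destruct HE as (Ec & Ee & HE).
        destruct IH as (s & Hs & P); [exact HE|intros w Hw; apply H2; now right|].
        destruct (H2 _ (or_introl eq_refl)) as [Nc Ne]. simpl in Nc, Ne.
        exists (Rmin s (Rmin (dist b c) (dist b e))). split.
        + repeat apply Rmin_pos; auto.
        + generalize (Rmin_l s (Rmin (dist b c) (dist b e))) (Rmin_r s (Rmin (dist b c) (dist b e)))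
            (Rmin_l (dist b c) (dist b e)) (Rmin_r (dist b c) (dist b e)). intros M1 M2 M3 M4.
          intros w [<-|Hw]; simpl; [lra|]. destruct (P _ Hw). lra. }
    exists (Rmin s (Rmin s' (dist b a))). split.
    + repeat apply Rmin_pos; auto.
    + generalize (Rmin_l s (Rmin s' (dist b a))) (Rmin_r s (Rmin s' (dist b a)))
        (Rmin_l s' (dist b a)) (Rmin_r s' (dist b a)). intros.
      split; [lra|]. split; [|apply (weaken s); assumption].
      intros e He. destruct (HF' e He). lra.
Qed.

Lemma robust_general (K : pt -> Prop) : (forall x, K x -> E x) ->
  (forall n, robust E D n K) -> general D K.
Proof.
  intros HK HR F HF Hf HD.
  assert (HE : on_vertices E F) by (intros e He; destruct (HF e He); auto).
  destruct (forest_separation F HE Hf) as (s & Hs & Hsep).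
  destruct (archimed_cor1 s Hs) as (N & HN & HN0).
  (* One index meets both demands: its gap is below [s], and it admits [length F] edges. *)
  destruct (HR (N + length F)%nat) as (d & Hd & P). apply P; [|clear P|lia|exact HD].
  - intros e He. destruct (HF e He) as [K1 K2].
    split; (split; [auto|]); [exists (fst e) | exists (snd e)]; (split; [assumption|now rewrite dist_refl]).
  - rewrite <- (map_edges_id F) at 1.
    apply (forest_map _ K (fun x y => s <= dist x y)); [|exact HF|exact Hsep].
    intros x y _ _ Hxy. eapply Rle_trans; [|exact Hxy]. apply Rlt_le.
    eapply Rle_lt_trans; [|exact HN]. apply Rinv_le_contravar; [now apply lt_0_INR|].
    apply le_INR. lia.
Qed.

Lemma cantor_bounded (K : pt -> Prop) (x0 : pt) : is_cantor E K -> E x0 ->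
  exists C, forall x, K x -> dist x0 x <= C.
Proof.
  intros HK E0. destruct (is_cantor_param E K HK) as (G & HG). destruct HK as [HK _].
  (* The bound is encoded as the inverse of the radius, so that the uniform radius is also a uniform
     bound. *)
  destruct (cantor_compact K G (fun d y => 0 < d -> dist x0 y <= / d) HK HG) as (d & Hd & P).
  - intros d d' y Hd P Hd'. eapply Rle_trans; [apply P; lra|]. apply Rinv_le_contravar; lra.
  - intros x Kx. assert (D0 := dist_pos x0 x). exists (/ (dist x0 x + 1)).
    split; [apply Rinv_0_lt_compat; lra|]. intros y Ey Hy _. rewrite Rinv_inv.
    assert (/ (dist x0 x + 1) <= 1).
    { rewrite <- Rinv_1 at 2. apply Rinv_le_contravar; lra. }
    generalize (dist_tri x0 x y (amb_l2 _ _ amb _ E0) (amb_l2 _ _ amb _ (HK _ Kx)) (amb_l2 _ _ amb _ Ey)).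
    lra.
  - exists (/ d). intros x Kx. apply P; [|exact Hd]. split; [auto|]. exists x.
    now rewrite dist_refl.
Qed.

(** Boundedness of [L], a consequence of compactness, makes the excess of [L] over [K] a true
    supremum, which the Hausdorff distance dominates; the infimum in [dist_to] then supplies the
    point [x]. *)
Lemma hausdorff_lt_near (K L : pt -> Prop) (e : R) : is_cantor E K -> is_cantor E L ->
  hausdorff K L < e -> forall y, L y -> exists x, K x /\ dist x y < e.
Proof.
  intros HK HL H y Ly.
  assert (nK : exists x, K x).
  { destruct (is_cantor_param E K HK) as (G & HG & _). now exists (G (fun _ => true)). }
  destruct nK as (x0 & Kx0).
  destruct (cantor_bounded L x0 HL (proj1 HK _ Kx0)) as (C & HC).
  assert (B : forall a, L a -> dist_to K a <= C).
  { intros a La. eapply Rle_trans; [|apply (HC a La)]. rewrite (dist_sym x0).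
    now apply dist_to_spec; [exists x0|]. }
  generalize (dist_to_le_exc L K C y B Ly). intros H1.
  assert (H2 : dist_to K y < e).
  { eapply Rle_lt_trans; [exact H1|]. eapply Rle_lt_trans; [|exact H]. apply Rmax_r. }
  destruct (dist_to_spec K y (ex_intro _ x0 Kx0)) as (_ & _ & S).
  destruct (S e H2) as (x & Kx & Hx). exists x. now rewrite dist_sym.
Qed.

Lemma robust_is_open (n : nat) : open_in_C E (robust E D n).
Proof.
  intros K HK (d & Hd & P). exists (d / 2). split; [lra|]. intros L HL Hh.
  exists (d / 2). split; [lra|]. intros F HF. apply P.
  assert (K1 : forall y, near E L (d / 2) y -> near E K d y).
  { intros y (Ey & z & Lz & Hz). split; [exact Ey|].
    destruct (hausdorff_lt_near K L (d / 2) HK HL Hh z Lz) as (x & Kx & Hx).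
    exists x. split; [exact Kx|].
    generalize (dist_tri x z y (amb_l2 _ _ amb _ (proj1 HK _ Kx))
      (amb_l2 _ _ amb _ (proj1 HL _ Lz)) (amb_l2 _ _ amb _ Ey)). lra. }
  intros e He. destruct (HF e He). auto.
Qed.

Lemma hausdorff_le_of_param (K L : pt -> Prop) (G H : (nat -> bool) -> pt) (e : R) :
  cantor_param K G -> cantor_param L H -> (forall a, dist (G a) (H a) <= e) -> hausdorff K L <= e.
Proof.
  intros (GK & Gs & _) (HL & Hs & _) B.
  assert (K0 : exists x, K x) by (exists (G (fun _ => true)); auto).
  assert (L0 : exists x, L x) by (exists (H (fun _ => true)); auto).
  apply Rmax_lub; apply exc_le; auto.
  - intros x Kx. destruct (Gs x Kx) as (a & <-).
    eapply Rle_trans; [apply (dist_to_spec L _ L0), HL | apply B].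
  - intros x Lx. destruct (Hs x Lx) as (a & <-).
    eapply Rle_trans; [apply (dist_to_spec K _ K0), GK|]. rewrite dist_sym. apply B.
Qed.

End Ambient.

(** * Fibres and forests *)


Notation distinct := (fun x y => x <> y).

(** A fibre listed as [c :: l] is turned into a tree with as many edges as the fibre contributes to
    the sum in [gen_pos]; its differences also test the affine independence of the fibre. *)
Definition star {V : Type} (c : V) (l : list V) : list (V * V) := map (fun b => (c, b)) l.

Lemma forest_star {V : Type} (c : V) (l : list V) (F : list (V * V)) :
  NoDup (c :: l) -> (forall b e, In b l -> In e F -> b <> fst e /\ b <> snd e) ->
  forest distinct F -> forest distinct (star c l ++ F).
Proof.
  intros Hn HF Hf. apply NoDup_cons_iff in Hn. destruct Hn as [Hc Hn].
  induction Hn as [|b l Hb Hn IH]; simpl in *; [exact Hf|].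
  split; [intros ->; tauto|]. split.
  - intros e He. apply in_app_iff in He. destruct He as [He|He]; [|now apply HF; [left|]].
    apply in_map_iff in He. destruct He as (b' & <- & Hb'). simpl.
    split; intros ->; tauto.
  - apply IH; [tauto|]. intros b' e Hb' He. apply HF; auto.
Qed.

Lemma forest_edge_distinct {V : Type} (F : list (V * V)) (e : V * V) :
  forest distinct F -> In e F -> snd e <> fst e.
Proof.
  induction F as [|(a, b) F IH]; [intros _ []|].
  intros (H & _ & Hf) [<-|He]; [exact H|now apply IH].
Qed.

Lemma in_star {V : Type} (c : V) (l : list V) (e : V * V) :
  In e (star c l) -> fst e = c /\ In (snd e) l.
Proof. intros H. apply in_map_iff in H. destruct H as (b & <- & Hb). auto. Qed.

Lemma max_length {A : Type} (P : list A -> Prop) (k : nat) (l0 : list A) : P l0 ->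
  (forall l, P l -> (length l <= k)%nat) ->
  exists l, P l /\ forall l', P l' -> (length l' <= length l)%nat.
Proof.
  intros H0. induction k as [|k IH]; intros Hk.
  - exists l0. split; [exact H0|]. intros l' H'. specialize (Hk _ H'). lia.
  - destruct (classic (exists l, P l /\ length l = S k)) as [(l & Hl & El)|N].
    + exists l. split; [exact Hl|]. rewrite El. exact Hk.
    + apply IH. intros l Hl. specialize (Hk l Hl).
      destruct (Nat.eq_dec (length l) (S k)); [exfalso; eauto | lia].
Qed.

Lemma finite_enum {A : Type} (P : A -> Prop) (L : list A) : (forall x, P x -> In x L) ->
  exists l, NoDup l /\ forall x, P x <-> In x l.
Proof.
  revert P. induction L as [|a L IH]; intros P H.
  - exists []. split; [constructor|]. intros x. split; [apply H | intros []].
  - destruct (IH (fun x => P x /\ x <> a)) as (l & Hn & Hl).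
    { intros x [Px Nx]. destruct (H x Px); [congruence|assumption]. }
    destruct (classic (P a)) as [Pa|Pa].
    + exists (a :: l). split.
      * constructor; [|exact Hn]. intros Ha. apply Hl in Ha. tauto.
      * intros x. simpl. rewrite <- Hl. destruct (classic (x = a)); subst; tauto || intuition congruence.
    + exists l. split; [exact Hn|]. intros x. rewrite <- Hl.
      split; [|tauto]. intros Px. split; [exact Px|]. now intros ->.
Qed.

Lemma lcomb_sub (cs : list R) (l : list pt) (c : pt) (n : nat) : length cs = length l ->
  lcomb cs (map (fun b n => b n - c n) l) n = lcomb cs l n - fold_right Rplus 0 cs * c n.
Proof.
  revert cs. induction l as [|b l IH]; intros [|x cs] Hl; try discriminate; simpl; [ring|].
  rewrite IH by (now injection Hl). ring.
Qed.

Lemma aff_indep_of_diffs (c : pt) (l : list pt) : lin_indep (diffs (star c l)) -> aff_indep (c :: l).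
Proof.
  unfold diffs, star. rewrite map_map. simpl. intros H [|x cs] Hl Hs E; [discriminate|].
  injection Hl as Hl. simpl in Hs, E.
  assert (Z : forall y, In y cs -> y = 0).
  { apply H; [now rewrite length_map|]. intros n. rewrite lcomb_sub by exact Hl.
    specialize (E n). replace (fold_right Rplus 0 cs) with (- x) by lra. lra. }
  intros y [<-|Hy]; [|auto].
  assert (fold_right Rplus 0 cs = 0); [|lra].
  clear - Z. induction cs as [|y cs IH]; simpl; [reflexivity|].
  rewrite (Z y (or_introl eq_refl)), IH; [ring|]. intros; apply Z; now right.
Qed.

Definition excess {A : Type} (ls : list (list A)) : nat :=
  fold_right (fun l acc => (length l - 1) + acc)%nat 0%nat ls.

(* The tail of the deepest edge is never a head. *)
Lemma forest_root {V : Type} (F : list (V * V)) : forest distinct F -> F <> [] ->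
  exists r e, In e F /\ r = fst e /\ NoDup (r :: map snd F).
Proof.
  induction F as [|(a, b) F IH]; [congruence|]. simpl. intros (H1 & H2 & H3) _.
  destruct F as [|e0 F].
  - exists a, (a, b). split; [now left|]. split; [reflexivity|].
    repeat constructor; simpl; intuition congruence.
  - destruct IH as (r & e & He & -> & Hn); [exact H3|discriminate|].
    exists (fst e), e. split; [now right|]. split; [reflexivity|].
    apply NoDup_cons_iff in Hn. destruct Hn as [Hr Hn].
    assert (Hb : ~ In b (map snd (e0 :: F))).
    { intros Hb. apply in_map_iff in Hb. destruct Hb as (e' & E' & He'). now apply (proj2 (H2 e' He')). }
    constructor; [|now constructor].
    intros [E|E]; [|exact (Hr E)]. exact (proj1 (H2 e He) E).
Qed.

(** The heads are pairwise distinct, one for each edge, and [forest_root] provides one more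
    vertex. *)
Lemma forest_edges_lt_vertices {V : Type} (F : list (V * V)) (l : list V) :
  forest distinct F -> on_vertices (fun v => In v l) F -> (length F <= length l - 1)%nat.
Proof.
  intros Hf Hl. destruct F as [|e0 F0] eqn:EF; [simpl; lia|]. rewrite <- EF in *.
  destruct (forest_root F Hf) as (r & e & He & -> & Hn); [rewrite EF; discriminate|].
  assert (length (fst e :: map snd F) <= length l)%nat.
  { apply NoDup_incl_length; [exact Hn|]. intros v [<-|Hv]; [now apply Hl|].
    apply in_map_iff in Hv. destruct Hv as (e' & <- & He'). now apply Hl. }
  simpl in H. rewrite length_map in H. lia.
Qed.

Lemma forest_split {V : Type} (P : V -> Prop) (F : list (V * V)) : forest distinct F ->
  exists F1 F2, length F = (length F1 + length F2)%nat /\ forest distinct F1 /\ forest distinct F2 /\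
    (forall e, In e F1 -> In e F /\ P (snd e)) /\ (forall e, In e F2 -> In e F /\ ~ P (snd e)).
Proof.
  induction F as [|(a, b) F IH]; simpl.
  - intros _. exists [], []. simpl. repeat split; tauto.
  - intros (H1 & H2 & H3). destruct (IH H3) as (F1 & F2 & Hl & Hf1 & Hf2 & I1 & I2).
    destruct (classic (P b)) as [Pb|Pb].
    + exists ((a, b) :: F1), F2. simpl. split; [lia|]. split; [|split; [exact Hf2|split]].
      * split; [exact H1|]. split; [|exact Hf1]. intros e He. apply H2. now apply I1.
      * intros e [<-|He]; [auto|]. destruct (I1 e He). auto.
      * intros e He. destruct (I2 e He). auto.
    + exists F1, ((a, b) :: F2). simpl. split; [lia|]. split; [exact Hf1|]. split; [|split].
      * split; [exact H1|]. split; [|exact Hf2]. intros e He. apply H2. now apply I2.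
      * intros e He. destruct (I1 e He). auto.
      * intros e [<-|He]; [auto|]. destruct (I2 e He). auto.
Qed.

Lemma NoDup_app_disjoint {A : Type} (l l' : list A) (a : A) :
  NoDup (l ++ l') -> In a l -> ~ In a l'.
Proof.
  intros Hn Ha. apply in_split in Ha. destruct Ha as (l1 & l2 & ->).
  rewrite <- app_assoc in Hn. apply NoDup_remove_2 in Hn. rewrite !in_app_iff in Hn. tauto.
Qed.

(** Edges are sorted by the class of their head. The classes are disjoint, so the tail lies in the
    same class, and within one class a forest has fewer edges than the class has points. *)
Lemma forest_le_excess {V : Type} (ls : list (list V)) (F : list (V * V)) : forest distinct F ->
  NoDup (concat ls) -> (forall e, In e F -> exists l, In l ls /\ In (fst e) l /\ In (snd e) l) ->
  (length F <= excess ls)%nat.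
Proof.
  revert F. induction ls as [|l ls IH]; intros F Hf Hn HF.
  - destruct F as [|e F]; [simpl; lia|]. destruct (HF e (or_introl eq_refl)) as (l & [] & _).
  - destruct (forest_split (fun v => In v l) F Hf) as (F1 & F2 & -> & Hf1 & Hf2 & I1 & I2).
    simpl in *.
    assert (disj : forall v l', In v l -> In l' ls -> In v l' -> False).
    { intros v l' Hv Hl' Hv'. apply (NoDup_app_disjoint _ _ v Hn Hv). apply in_concat. eauto. }
    assert (length F1 <= length l - 1)%nat.
    { apply forest_edges_lt_vertices; [exact Hf1|]. intros e He. destruct (I1 e He) as [He' Hs].
      split; [|exact Hs]. destruct (HF e He') as (l' & [<-|Hl'] & Ha & Hb); [exact Ha|].
      exfalso; eauto. }
    assert (length F2 <= excess ls)%nat.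
    { apply IH; [exact Hf2| |].
      - now apply NoDup_app_remove_l in Hn.
      - intros e He. destruct (I2 e He) as [He' Hs].
        destruct (HF e He') as (l' & [<-|Hl'] & Ha & Hb); [tauto|]. eauto. }
    unfold excess in *. lia.
Qed.

Section Fibers.
Variables (E : pt -> Prop) (D : nat -> Prop).
Hypothesis amb : ambient E D.
Variable M : pt -> Prop.
Hypothesis HM : forall x, M x -> E x.

Lemma amb_span (vs : list pt) (x : pt) : (forall v, In v vs -> E v) -> in_span vs x -> E x.
Proof.
  revert x. induction vs as [|v vs IH]; intros x H Hx.
  - rewrite in_span_nil in Hx. replace x with (fun _ : nat => 0) by (extensionality n; auto).
    apply (amb_zero _ _ amb).
  - apply in_span_cons in Hx. destruct Hx as (c & s & Hs & Es).
    replace x with (fun n => c * v n + s n) by (extensionality n; auto).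
    apply (amb_lin _ _ amb); [apply H; now left|]. apply IH; [intros; apply H; now right|exact Hs].
Qed.

(** Replaces projections by translates of the span. For the converse, the projection [y] of [A] also
    serves [B], because [B - y] is the difference of [A - y] and [A - B]. *)
Lemma fiber_iff (vs : list pt) (A B : pt) : (forall v, In v vs -> E v) -> M A ->
  fiber E vs M A B <-> M B /\ in_span vs (fun n => A n - B n).
Proof.
  intros Hvs MA. split.
  - intros (MB & y & (_ & HA & _) & (_ & HB & _)). split; [exact MB|]. eapply in_span_sub; eauto.
  - intros (MB & HAB). split; [exact MB|].
    destruct (proj_exists vs A) as (y & Ly & Hy & Ho).
    { intros; apply (amb_l2 _ _ amb); auto. } { apply (amb_l2 _ _ amb); auto. }
    assert (Ey : E y).
    { replace y with (fun n => (-1) * (A n - y n) + A n) by (extensionality n; ring).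
      apply (amb_lin _ _ amb); [eapply amb_span; eauto | auto]. }
    exists y. split; (split; [exact Ey|split; [|exact Ho]]); [exact Hy|].
    eapply in_span_ext; [exact (in_span_lin _ (-1) _ _ HAB Hy)|]. intros n. simpl. ring.
Qed.

(** [D (S (length vs))] stands for properness of the span: for an independent [vs] in R^N it says
    [length vs < N], and in l2 it always holds. *)
Definition gp_upto : Prop := forall vs, (forall v, In v vs -> E v) -> lin_indep vs -> vs <> [] ->
  D (S (length vs)) -> gen_pos E vs M.

Definition span_edges (vs : list pt) (F : list (pt * pt)) : Prop :=
  forall e, In e F -> in_span vs (fun n => snd e n - fst e n).

Lemma general_forest_length (vs : list pt) (F : list (pt * pt)) : general D M ->
  D (S (length vs)) -> on_vertices M F -> forest distinct F -> span_edges vs F ->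
  (length F <= length vs)%nat.
Proof.
  intros Hg HD HF Hf Hs. apply Nat.nlt_ge. intros Hlt.
  (* [general] only covers forests of admissible length, so a forest that is too long is cut to its
     last [S (length vs)] edges; these are one too many for Steinitz. *)
  set (F' := skipn (length F - S (length vs)) F).
  assert (Hl : length F' = S (length vs)) by (unfold F'; rewrite length_skipn; lia).
  assert (Hi : incl F' F).
  { intros e He. rewrite <- (firstn_skipn (length F - S (length vs)) F). apply in_app_iff. now right. }
  assert (length (diffs F') <= length vs)%nat.
  { apply steinitz.
    - apply Hg; [intros e He; apply HF; auto | now apply forest_skipn | now rewrite Hl].
    - intros w Hw. apply in_map_iff in Hw. destruct Hw as (e & <- & He). apply Hs; auto. }
  rewrite length_diffs, Hl in H. lia.
Qed.

(** Forests in [M] with all edges in the span of [vs] have at most [length vs] edges, so a longest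
    one exists. Its vertices contain every point of every non-degenerate fibre, which yields
    finiteness; stars on the fibres then give the two counting clauses and affine independence. *)
Lemma general_gp : general D M -> gp_upto.
Proof.
  intros Hg vs Hvs Hi Hne HD.
  set (good F := on_vertices M F /\ forest distinct F /\ span_edges vs F).
  assert (Hk : forall F, good F -> (length F <= length vs)%nat).
  { intros F (H1 & H2 & H3). now apply general_forest_length. }
  destruct (max_length good (length vs) []) as (F & (HF & Hf & Hs) & Hmax); [|exact Hk|].
  { split; [intros e []|]. split; [exact I|intros e []]. }
  set (vertices := map fst F ++ map snd F).
  (* If [B] were missing, the edge from [A] to [B] could be put in front of the longest forest. *)
  assert (Hin : forall A B, M A -> M B -> B <> A -> in_span vs (fun n => A n - B n) -> In B vertices).
  { intros A B MA MB N HAB. apply NNPP. intros NB.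
    assert (good ((A, B) :: F)).
    { split; [now apply on_vertices_cons|]. split.
      - split; [exact N|]. split; [|exact Hf]. intros e He.
        unfold vertices in NB. rewrite in_app_iff in NB.
        split; intros ->; apply NB; [left | right]; now apply in_map.
      - intros e [<-|He]; [|auto]. simpl. now apply in_span_opp. }
    specialize (Hmax _ H). simpl in Hmax. lia. }
  split; [|split].
  - exists vertices. intros A MA (B & HB & N). apply fiber_iff in HB; auto. destruct HB as [MB HAB].
    exists B. split; [now apply (Hin A)|]. split; [exact MB|]. intros C.
    rewrite !fiber_iff by auto. split; intros [MC HC]; (split; [exact MC|]).
    + apply (in_span_ext _ (fun n => (-1) * (A n - B n) + (A n - C n))); [|intros; ring].
      now apply in_span_lin.
    + apply (in_span_ext _ (fun n => 1 * (A n - B n) + (B n - C n))); [|intros; ring].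
      now apply in_span_lin.
  - intros A MA (B & HB & N). apply fiber_iff in HB; auto. destruct HB as [MB HAB].
    destruct (finite_enum (fiber E vs M A) vertices) as (l & Hn & Hl).
    { intros C HC. apply fiber_iff in HC; auto. destruct HC as [MC HC].
      destruct (classic (C = A)) as [->|]; [|now apply (Hin A)].
      apply (Hin B); auto. now apply in_span_opp. }
    exists l. split; [split; assumption|].
    destruct l as [|c l].
    { exfalso. apply (Hl A). apply fiber_iff; auto. split; [exact MA|].
      eapply in_span_ext; [apply in_span_0|]. intros; simpl; ring. }
    assert (Hfl : forall b, In b (c :: l) -> M b /\ in_span vs (fun n => A n - b n)).
    { intros b Hb. apply fiber_iff; auto. now apply Hl. }
    assert (Hst : good (star c l)).
    { split; [|split].
      - intros e He. apply in_star in He. destruct He as [-> He]. split; apply Hfl; simpl; auto.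
      - rewrite <- (app_nil_r (star c l)). apply forest_star; [exact Hn|intros b e _ []|exact I].
      - intros e He. apply in_star in He. destruct He as [-> He].
        destruct (Hfl c (or_introl eq_refl)) as [_ Hc]. destruct (Hfl _ (or_intror He)) as [_ Hb].
        apply (in_span_ext _ (fun n => (-1) * (A n - snd e n) + (A n - c n))); [|intros; ring].
        now apply in_span_lin. }
    assert (Hlen := Hk _ Hst). assert (El : length (star c l) = length l) by apply length_map.
    rewrite El in Hlen. split; [simpl; lia|].
    apply aff_indep_of_diffs. destruct Hst as (S1 & S2 & S3). apply Hg; auto.
    rewrite El. eapply amb_le; [exact amb| |exact HD]. lia.
  - intros ls Hn Hls.
    enough (exists F', good F' /\ length F' = excess ls) as (F' & HF' & HE).
    { unfold excess in HE. rewrite <- HE. now apply Hk. }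
    (* Recording where the vertices lie makes the heads of the next star fresh. *)
    enough (exists F', good F' /\ length F' = excess ls /\ on_vertices (fun v => In v (concat ls)) F')
      as (F' & H1 & H2 & _) by eauto.
    induction ls as [|l ls IH].
    + exists []. split; [|split; [reflexivity|intros e []]].
      split; [intros e []|]. split; [exact I|intros e []].
    + simpl in Hn. destruct IH as (F' & (G1 & G2 & G3) & Hl' & Hc).
      { now apply NoDup_app_remove_l in Hn. } { intros; apply Hls; now right. }
      destruct (Hls l (or_introl eq_refl)) as (A & MA & Hnl & Hl).
      (* An empty list adds no edge, in accordance with the truncated subtraction in [excess]. *)
      destruct l as [|c l].
      { exists F'. split; [split; auto|]. split; [exact Hl'|exact Hc]. }
      assert (Hfl : forall b, In b (c :: l) -> M b /\ in_span vs (fun n => A n - b n)).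
      { intros b Hb. apply fiber_iff; auto. now apply Hl. }
      exists (star c l ++ F'). split; [split; [|split]|split].
      * intros e He. apply in_app_iff in He. destruct He as [He|He]; [|auto].
        apply in_star in He. destruct He as [-> He]. split; apply Hfl; simpl; auto.
      * apply forest_star; [exact Hnl| |exact G2].
        intros b e Hb He. destruct (Hc e He) as [C1 C2].
        assert (Hd : ~ In b (concat ls)).
        { apply (NoDup_app_disjoint (c :: l) _ _ Hn). now right. }
        split; intros ->; auto.
      * intros e He. apply in_app_iff in He. destruct He as [He|He]; [|auto].
        apply in_star in He. destruct He as [-> He].
        destruct (Hfl c (or_introl eq_refl)) as [_ H1]. destruct (Hfl _ (or_intror He)) as [_ H2].
        apply (in_span_ext _ (fun n => (-1) * (A n - snd e n) + (A n - c n))); [|intros; ring].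
        now apply in_span_lin.
      * rewrite length_app. unfold star. rewrite length_map. simpl. rewrite Hl'. unfold excess. lia.
      * intros e He. simpl. rewrite !in_app_iff. apply in_app_iff in He. destruct He as [He|He].
        { apply in_star in He. destruct He as [-> He]. auto. }
        destruct (Hc e He). auto.
Qed.

(** A fibre is added only for a point not yet covered. Fibres are classes of an equivalence
    relation, so the new one is disjoint from those already listed, as the third clause of [gen_pos]
    demands. *)
Lemma cover_by_fibers (vs V : list pt) : (forall v, In v vs -> E v) -> gen_pos E vs M ->
  (forall v, In v V -> M v /\ nondeg_fiber E vs M v) ->
  exists ls, NoDup (concat ls) /\ (forall l, In l ls -> exists A, M A /\ enum_fiber E vs M A l) /\
    forall v, In v V -> exists l, In l ls /\ In v l.
Proof.
  intros Hvs (_ & Hen & _) HV. induction V as [|v V IH].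
  - exists []. split; [constructor|]. split; intros ? [].
  - destruct IH as (ls & Hn & Hls & Hc); [intros; apply HV; now right|].
    destruct (classic (exists l, In l ls /\ In v l)) as [Hv|Hv].
    + exists ls. split; [exact Hn|]. split; [exact Hls|]. intros w [<-|Hw]; auto.
    + destruct (HV v (or_introl eq_refl)) as [Mv Nv].
      destruct (Hen v Mv Nv) as (l & (Hnl & Hl) & _).
      assert (Hvl : In v l).
      { apply Hl, fiber_iff; auto. split; [exact Mv|].
        eapply in_span_ext; [apply in_span_0|]. intros; simpl; ring. }
      exists (l :: ls). split; [|split].
      * simpl. apply NoDup_app; [exact Hnl|exact Hn|]. intros w Hw Hw'.
        apply in_concat in Hw'. destruct Hw' as (l' & Hl' & Hwl').
        apply Hv. exists l'. split; [exact Hl'|].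
        destruct (Hls l' Hl') as (A & MA & _ & HA).
        apply HA. apply HA in Hwl'. apply Hl in Hw. rewrite fiber_iff in * by auto.
        destruct Hw as [_ H1]. destruct Hwl' as [_ H2]. split; [exact Mv|].
        now apply (in_span_sub _ _ _ w).
      * intros l' [<-|Hl']; [|auto]. exists v. split; [exact Mv|split; assumption].
      * intros w [<-|Hw]; [exists l; split; [now left|exact Hvl]|].
        destruct (Hc w Hw) as (l' & H1 & H2). exists l'. split; [now right|exact H2].
Qed.

(** If the first difference lay in the span H of the others, all [S (length F)] edges would lie
    inside fibres over H. By [forest_le_excess] the sum over these fibres would then exceed
    [length F], the dimension of H. *)
Lemma gp_general : gp_upto -> general D M.
Proof.
  intros Hgp F. induction F as [|(a, b) F IH]; intros HF Hf HD; [apply lin_indep_nil|].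
  apply on_vertices_cons in HF. destruct HF as (Ma & Mb & HF).
  destruct Hf as (Hba & Hbv & Hf).
  assert (Hi : lin_indep (diffs F)).
  { apply IH; auto. eapply amb_le; [exact amb| |exact HD]. simpl. lia. }
  change (diffs ((a, b) :: F)) with ((fun n => b n - a n) :: diffs F).
  apply lin_indep_cons. split; [|exact Hi]. intros Hsp.
  set (vs := diffs F) in *.
  assert (Hlen : length vs = length F) by apply length_diffs.
  assert (Hvs : forall v, In v vs -> E v).
  { intros v Hv. apply in_map_iff in Hv. destruct Hv as (e & <- & He). destruct (HF e He).
    replace (fun n => snd e n - fst e n) with (fun n => (-1) * fst e n + snd e n)
      by (extensionality n; ring).
    apply (amb_lin _ _ amb); auto. }
  assert (Hne : vs <> []).
  { intros Z. rewrite Z in Hsp. rewrite in_span_nil in Hsp. apply Hba. extensionality n.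
    specialize (Hsp n). lra. }
  assert (Hgen : gen_pos E vs M).
  { apply Hgp; auto. rewrite Hlen. exact HD. }
  set (F1 := (a, b) :: F).
  assert (HF1 : on_vertices M F1) by now apply on_vertices_cons.
  assert (Hf1 : forest distinct F1) by (repeat split; auto; apply Hbv; auto).
  assert (Hs1 : span_edges vs F1).
  { intros e [<-|He]; [exact Hsp|]. apply in_span_In. unfold vs, diffs.
    apply in_map_iff. eauto. }
  assert (Hd1 : forall e, In e F1 -> snd e <> fst e).
  { intros e. now apply forest_edge_distinct. }
  (* Covering the tails suffices, because each head lies in the fibre of its tail. *)
  destruct (cover_by_fibers vs (map fst F1) Hvs Hgen) as (ls & Hn & Hls & Hc).
  { intros v Hv. apply in_map_iff in Hv. destruct Hv as (e & <- & He).
    destruct (HF1 e He) as [M1 M2]. split; [exact M1|]. exists (snd e). split; [|now apply Hd1].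
    apply fiber_iff; auto. split; [exact M2|]. now apply in_span_opp, Hs1. }
  assert (length F1 <= excess ls)%nat.
  { apply forest_le_excess; auto. intros e He.
    destruct (Hc (fst e)) as (l & Hl & Hin); [now apply in_map|].
    exists l. split; [exact Hl|]. split; [exact Hin|].
    destruct (Hls l Hl) as (A & MA & _ & HA). apply HA. apply HA in Hin.
    destruct (HF1 e He) as [M1 M2]. rewrite fiber_iff in * by auto.
    destruct Hin as [_ Hin]. split; [exact M2|].
    apply (in_span_ext _ (fun n => (-1) * (snd e n - fst e n) + (A n - fst e n))); [|intros; ring].
    apply in_span_lin; [now apply Hs1|exact Hin]. }
  destruct Hgen as (_ & _ & H3). specialize (H3 ls Hn Hls). fold (excess ls) in H3.
  rewrite Hlen in H3. unfold F1 in H. simpl in H. lia.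
Qed.

End Fibers.

(** * Perturbation along the binary tree *)


Lemma lists_upto_finite {A : Type} (X : list A) (k : nat) :
  exists LL, forall l, incl l X -> (length l <= k)%nat -> In l LL.
Proof.
  induction k as [|k (LL & H)].
  - exists [[]]. intros [|a l] _ Hl; [now left|simpl in Hl; lia].
  - exists ([] :: flat_map (fun x => map (cons x) LL) X). intros [|a l] Hi Hl; [now left|].
    right. apply in_flat_map. exists a. split; [apply Hi; now left|].
    apply in_map, H; [|simpl in Hl; lia]. intros z Hz. apply Hi. now right.
Qed.

Lemma words_finite (n : nat) : exists N : list (list bool), forall s, length s = n -> In s N.
Proof.
  destruct (lists_upto_finite [true; false] n) as (N & H). exists N. intros s Hs.
  apply H; [|lia]. intros [|] _; simpl; auto.
Qed.

Lemma ex_series_bounded (a : nat -> R) (C : R) : (forall i, 0 <= a i) ->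
  (forall n, sum_n a n <= C) -> ex_series a /\ Series a <= C.
Proof.
  intros Ha HC.
  assert (Hi : forall n, sum_n a n <= sum_n a (S n)).
  { intros n. rewrite sum_Sn. unfold plus; simpl. specialize (Ha (S n)). lra. }
  destruct (ex_finite_lim_seq_incr (sum_n a) C Hi HC) as (l & Hl).
  split; [exists l; exact Hl|].
  rewrite (is_series_unique a l Hl).
  exact (is_lim_seq_le _ _ _ _ HC Hl (is_lim_seq_const C)).
Qed.

(** The limit is taken coordinatewise. Each finite partial sum of squares passes to the limit below
    [r k ^ 2], and the series is bounded through its partial sums, as in Fatou's lemma. *)
Lemma l2_complete (x : nat -> pt) (r : nat -> R) : (forall k, l2 (x k)) ->
  (forall k j, dist (x k) (x (j + k)%nat) <= r k) ->
  (forall eps, 0 < eps -> exists k, r k < eps) ->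
  exists y, l2 y /\ forall k, dist (x k) y <= r k.
Proof.
  intros Hx Hd Hr.
  assert (Hc : forall i k j, Rabs (x k i - x (j + k)%nat i) <= r k).
  { intros i k j. eapply Rle_trans; [|apply (Hd k j)]. rewrite dist_norm.
    apply (coord_le_norm (fun i => x k i - x (j + k)%nat i)). now apply l2_sub. }
  assert (Hl : forall i, exists l : R, is_lim_seq (fun k => x k i) l).
  { intros i. apply ex_lim_seq_cauchy_corr. intros eps.
    destruct (Hr (eps / 2)) as (k & Hk); [generalize (cond_pos eps); lra|].
    exists k. intros n m Hn Hm.
    generalize (Hc i k (n - k)%nat) (Hc i k (m - k)%nat).
    replace (n - k + k)%nat with n by lia. replace (m - k + k)%nat with m by lia. intros H1 H2.
    replace (x n i - x m i) with ((x k i - x m i) - (x k i - x n i)) by ring.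
    eapply Rle_lt_trans; [apply Rabs_triang|]. rewrite Rabs_Ropp. lra. }
  apply functional_choice in Hl. destruct Hl as (y & Hy).
  assert (K : forall k, l2 (fun i => x k i - y i) /\ Series (fun i => (x k i - y i) ^ 2) <= r k ^ 2).
  { intros k. apply ex_series_bounded; [intros; apply pow2_ge_0|]. intros n.
    assert (L : is_lim_seq (fun j => sum_n (fun i => (x k i - x (j + k)%nat i) ^ 2) n)
      (sum_n (fun i => (x k i - y i) ^ 2) n)).
    { assert (T : forall i, is_lim_seq (fun j => (x k i - x (j + k)%nat i) ^ 2) ((x k i - y i) ^ 2)).
      { intros i. simpl.
        assert (S : is_lim_seq (fun j => x k i - x (j + k)%nat i) (x k i - y i)).
        { apply is_lim_seq_minus'; [apply is_lim_seq_const|].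
          now apply (is_lim_seq_incr_n (fun j => x j i)). }
        apply is_lim_seq_mult'; [exact S|]. apply is_lim_seq_mult'; [exact S|].
        apply is_lim_seq_const. }
      induction n as [|n IH].
      - rewrite sum_O. eapply is_lim_seq_ext; [|apply T]. intros j. now rewrite sum_O.
      - rewrite sum_Sn. eapply is_lim_seq_ext; [|apply is_lim_seq_plus'; [apply IH|apply T]].
        intros j. now rewrite sum_Sn. }
    refine (is_lim_seq_le _ (fun _ => r k ^ 2) (Finite _) (Finite _) _ L (is_lim_seq_const _)).
    intros j. eapply Rle_trans.
    - apply sum_n_le_Series; [intros; apply pow2_ge_0|]. apply (l2_sub (x k) (x (j + k)%nat)); auto.
    - specialize (Hd k j). unfold dist in Hd.
      assert (P : 0 <= Series (fun i => (x k i - x (j + k)%nat i) ^ 2)).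
      { eapply Rle_trans; [|apply (sum_n_le_Series _ 0)].
        - rewrite sum_O. apply pow2_ge_0.
        - intros; apply pow2_ge_0.
        - apply (l2_sub (x k) (x (j + k)%nat)); auto. }
      rewrite <- (sqrt_sqrt _ P). generalize (sqrt_pos (Series (fun i => (x k i - x (j + k)%nat i) ^ 2))).
      intros. simpl. rewrite Rmult_1_r. now apply Rmult_le_compat. }
  exists y. split.
  - eapply l2_ext; [exact (l2_lin (-1) _ _ (proj1 (K 0%nat)) (Hx 0%nat))|]. intros n; simpl; ring.
  - intros k. unfold dist. rewrite <- (sqrt_pow2 (r k)).
    + apply sqrt_le_1_alt, K.
    + eapply Rle_trans; [|apply (Hd k 0%nat)]. apply dist_pos.
Qed.

Lemma finite_separation (V : list (nat -> bool)) : exists m, forall n, (m <= n)%nat ->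
  forall v w, In v V -> In w V -> prefix v n = prefix w n -> v = w.
Proof.
  assert (pair : forall v w : nat -> bool, exists m, forall n, (m <= n)%nat -> prefix v n = prefix w n -> v = w).
  { intros v w. destruct (classic (v = w)) as [E|N]; [now exists 0%nat|].
    destruct (classic (exists i, v i <> w i)) as [(i & Hi)|Hi].
    - exists (S i). intros n Hn E. apply prefix_agree in E. exfalso. apply Hi, E. lia.
    - exfalso. apply N. extensionality i. apply NNPP. eauto. }
  assert (one : forall v, exists m, forall n, (m <= n)%nat -> forall w, In w V -> prefix v n = prefix w n -> v = w).
  { intros v. induction V as [|w V (m & IH)]; [exists 0%nat; intros n _ w []|].
    destruct (pair v w) as (m' & Hm'). exists (m + m')%nat. intros n Hn z [<-|Hz] E.
    - apply (Hm' n); [lia|exact E].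
    - apply (IH n); [lia|exact Hz|exact E]. }
  enough (forall U, exists m, forall n, (m <= n)%nat ->
    forall v w, In v U -> In w V -> prefix v n = prefix w n -> v = w) as H by apply H.
  induction U as [|v U (m & IH)]; [exists 0%nat; intros n _ v w []|].
  destruct (one v) as (m' & Hm'). exists (m + m')%nat. intros n Hn z w [<-|Hz] Hw E.
  - apply (Hm' n); [lia|exact Hw|exact E].
  - apply (IH n); [lia|exact Hz|exact Hw|exact E].
Qed.

Lemma cantor_map_uniform (M : pt -> Prop) (G : (nat -> bool) -> pt) (eps : R) :
  (forall x, M x -> l2 x) -> cantor_param M G -> 0 < eps ->
  exists n, forall a b, agree n a b -> dist (G a) (G b) < eps.
Proof.
  intros HM (GM & _ & _ & Gc) He.
  enough (exists n, forall a b, prefix a (length (@nil bool)) = [] -> prefix b (length (@nil bool)) = [] ->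
    agree n a b -> dist (G a) (G b) < eps) as (n & H) by (exists n; intros; now apply H).
  apply (cantor_induction (fun s => exists n, forall a b, prefix a (length s) = s ->
    prefix b (length s) = s -> agree n a b -> dist (G a) (G b) < eps)).
  (* The length includes bit [length s], so that [a] and [b] enter the same child. *)
  - intros s (n1 & H1) (n2 & H2). exists (S (n1 + n2 + length s)). intros a b Ha Hb Hab.
    assert (E : a (length s) = b (length s)) by (apply Hab; lia).
    destruct (a (length s)) eqn:Ea.
    + apply H1; simpl; try congruence. intros i Hi. apply Hab. lia.
    + apply H2; simpl; try congruence. intros i Hi. apply Hab. lia.
  - intros a. destruct (Gc a (eps / 2)) as (n & Hn); [lra|]. exists n, 0%nat.
    intros b c Hb Hc _. rewrite length_prefix in *.
    assert (Hab : agree n a b) by (apply prefix_agree; congruence).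
    assert (Hac : agree n a c) by (apply prefix_agree; congruence).
    generalize (Hn b Hab) (Hn c Hac). rewrite (dist_sym (G c)).
    generalize (dist_tri (G b) (G a) (G c) (HM _ (GM b)) (HM _ (GM a)) (HM _ (GM c))). lra.
Qed.

Section Perturbation.
Variables (E : pt -> Prop) (D : nat -> Prop).
Hypothesis amb : ambient E D.

(** The head [b] occurs in no later edge, so moving its image leaves the remaining differences,
    already independent, untouched. The move follows a direction outside their span, which
    [amb_room] supplies. *)
Lemma forest_perturb {V : Type} (F : list (V * V)) (u : V -> pt) (r : R) :
  forest distinct F -> D (length F) -> (forall v, E (u v)) -> 0 < r ->
  exists u', (forall v, E (u' v) /\ dist (u v) (u' v) < r) /\ lin_indep (diffs (map_edges u' F)).
Proof.
  intros Hf HD Hu. revert r. induction F as [|(a, b) F IH]; intros r Hr.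
  - exists u. split; [|apply lin_indep_nil]. intros v. now rewrite dist_refl.
  - destruct Hf as (Hba & Hbv & Hf).
    destruct (IH Hf) with (r := r / 2) as (u1 & Hu1 & Hi); [|lra|].
    { eapply amb_le; [exact amb| |exact HD]. simpl. lia. }
    set (vs := diffs (map_edges u1 F)) in *.
    assert (Hl : length vs = length F) by (unfold vs; rewrite length_diffs; apply length_map).
    destruct (classic (in_span vs (fun n => u1 b n - u1 a n))) as [Hs|Hs].
    + destruct (amb_room _ _ amb vs) as (x & Ex & Hx); [now rewrite Hl|].
      (* Makes [t * norm x] smaller than [r / 2]; adding 1 keeps the denominator positive. *)
      set (t := r / 2 / (norm x + 1)).
      assert (Hn := norm_pos x).
      assert (Ht : 0 < t) by (apply Rdiv_lt_0_compat; lra).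
      set (u' := fun v => if excluded_middle_informative (v = b)
        then (fun n => t * x n + u1 b n) else u1 v).
      assert (ub : u' b = (fun n => t * x n + u1 b n)).
      { unfold u'. destruct (excluded_middle_informative (b = b)); [reflexivity|congruence]. }
      assert (uo : forall v, v <> b -> u' v = u1 v).
      { intros v Hv. unfold u'. destruct (excluded_middle_informative (v = b)); [congruence|reflexivity]. }
      exists u'. split.
      * intros v. destruct (classic (v = b)) as [->|Hv].
        -- rewrite ub. destruct (Hu1 b) as [Eb Hb].
           assert (Eb' : E (fun n => t * x n + u1 b n)) by now apply (amb_lin _ _ amb).
           split; [exact Eb'|].
           assert (dist (u1 b) (fun n => t * x n + u1 b n) <= t * norm x).
           { rewrite dist_sym, dist_norm.
             replace (fun n => t * x n + u1 b n - u1 b n) with (fun n => t * x n + 0)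
               by (extensionality n; ring).
             eapply Rle_trans; [apply (norm_lin t x (fun _ => 0)); [eapply amb_l2; eauto|apply l2_0]|].
             rewrite norm_0, Rabs_pos_eq; lra. }
           assert (t * norm x < r / 2).
           { replace (r / 2) with (t * (norm x + 1)) by (unfold t; field; lra). nra. }
           generalize (dist_tri (u b) (u1 b) _ (amb_l2 _ _ amb _ (Hu b)) (amb_l2 _ _ amb _ Eb)
             (amb_l2 _ _ amb _ Eb')). lra.
        -- rewrite uo by exact Hv. destruct (Hu1 v). split; [assumption|lra].
      * change (lin_indep ((fun n => u' b n - u' a n) :: diffs (map_edges u' F))).
        replace (map_edges u' F) with (map_edges u1 F).
        2:{ apply map_ext_in. intros e He. destruct (Hbv e He). rewrite !uo by auto. reflexivity. }
        apply lin_indep_cons. split; [|exact Hi]. rewrite ub, (uo a) by auto. intros Hs'.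
        apply Hx. fold vs in Hs'.
        eapply in_span_ext; [exact (in_span_lin _ (/ t) _ _
          (in_span_lin _ (-1) _ _ Hs Hs') (in_span_0 vs))|].
        intros n. simpl. field. lra.
    + exists u1. split; [intros v; destruct (Hu1 v); split; [assumption|lra]|].
      change (lin_indep ((fun n => u1 b n - u1 a n) :: vs)). now apply lin_indep_cons.
Qed.

(* The factor 2 keeps the limit of a nested sequence of balls strictly inside each of them. *)
Definition shrinks {V : Type} (u : V -> pt) (r : R) (u' : V -> pt) (r' : R) : Prop :=
  0 < r' /\ forall v, E (u' v) /\ dist (u v) (u' v) + 2 * r' <= r.

Definition inside {V : Type} (u : V -> pt) (r : R) (x : V -> pt) : Prop :=
  forall v, E (x v) /\ dist (u v) (x v) < r.

Lemma inside_shrinks {V : Type} (u u' x : V -> pt) (r r' : R) : (forall v, E (u v)) ->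
  shrinks u r u' r' -> inside u' r' x -> inside u r x.
Proof.
  intros Hu (Hr' & H) Hx v. destruct (H v) as [Ev Hv]. destruct (Hx v) as [Ex Hxv].
  split; [exact Ex|].
  generalize (dist_tri (u v) (u' v) (x v) (amb_l2 _ _ amb _ (Hu v)) (amb_l2 _ _ amb _ Ev)
    (amb_l2 _ _ amb _ Ex)). lra.
Qed.

(** The forests are treated one at a time. Each is made independent and the balls are then shrunk
    within its range of openness; forests treated earlier stay independent because the new balls lie
    inside the old ones. *)
Lemma forests_robust_perturb {V : Type} (FF : list (list (V * V))) (u : V -> pt) (r : R) :
  (forall v, E (u v)) -> 0 < r ->
  exists u' r', shrinks u r u' r' /\ forall F, In F FF -> forest distinct F -> D (length F) ->
    forall x, inside u' r' x -> lin_indep (diffs (map_edges x F)).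
Proof.
  intros Hu Hr. induction FF as [|F FF IH].
  - exists u, (r / 2). split; [|intros F []]. split; [lra|]. intros v. split; [auto|].
    rewrite dist_refl. lra.
  - destruct IH as (u1 & r1 & (Hr1 & H1) & HFF).
    destruct (classic (forest distinct F /\ D (length F))) as [[Hf HD]|N].
    + destruct (forest_perturb F u1 (r1 / 2) Hf HD) as (u2 & H2 & Hi); [apply H1|lra|].
      destruct (forest_open E D amb (map_edges u2 F)) as (d & Hd & Ho); [|exact Hi|].
      { intros e He. apply in_map_iff in He. destruct He as (e' & <- & _). split; apply H2. }
      assert (Hm : Rmin d (r1 / 4) <= d) by apply Rmin_l.
      assert (Hm' : Rmin d (r1 / 4) <= r1 / 4) by apply Rmin_r.
      assert (Hp : 0 < Rmin d (r1 / 4)) by (apply Rmin_pos; lra).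
      (* The move takes less than [r1 / 2], and twice the new radius at most the other half. *)
      assert (S12 : shrinks u1 r1 u2 (Rmin d (r1 / 4))).
      { split; [exact Hp|]. intros v. destruct (H2 v) as [Ev Hv]. split; [exact Ev|]. lra. }
      exists u2, (Rmin d (r1 / 4)). split.
      * split; [exact Hp|]. intros v. destruct (H1 v) as [Ev Hv]. destruct S12 as [_ S12].
        destruct (S12 v) as [Ev2 Hv2]. split; [exact Ev2|].
        generalize (dist_tri (u v) (u1 v) (u2 v) (amb_l2 _ _ amb _ (Hu v)) (amb_l2 _ _ amb _ Ev)
          (amb_l2 _ _ amb _ Ev2)). lra.
      * intros F' [<-|HF'] Hf' HD' x Hx.
        -- apply Ho.
           ++ intros e He. apply in_map_iff in He. destruct He as (e' & <- & _). split; apply Hx.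
           ++ clear - Hx Hm. induction F as [|e F IH]; simpl; constructor; [|exact IH].
              split; simpl; eapply Rlt_le_trans; try apply Hx; exact Hm.
        -- apply (HFF F' HF' Hf' HD'). eapply inside_shrinks; [|exact S12|exact Hx]. apply H1.
    + exists u1, r1. split; [split; assumption|]. intros F' [<-|HF'] Hf' HD'; [tauto|]. now apply HFF.
Qed.

Lemma level_perturb (n : nat) (u : list bool -> pt) (r : R) : (forall v, E (u v)) -> 0 < r ->
  exists u' r', shrinks u r u' r' /\ forall F, on_vertices (fun s => length s = n) F ->
    forest distinct F -> D (length F) ->
    forall x, inside u' r' x -> lin_indep (diffs (map_edges x F)).
Proof.
  intros Hu Hr. destruct (words_finite n) as (N & HN).
  destruct (lists_upto_finite (list_prod N N) (length N)) as (FF & HFF).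
  destruct (forests_robust_perturb FF u r Hu Hr) as (u' & r' & Hs & H).
  exists u', r'. split; [exact Hs|]. intros F HF Hf HD. apply H; auto.
  assert (HF' : on_vertices (fun s => In s N) F) by (intros e He; destruct (HF e He); auto).
  (* A forest has fewer edges than vertices, so the forests on one level form a finite family. *)
  apply HFF.
  - intros (s, t) He. apply in_prod; apply (HF' _ He).
  - generalize (forest_edges_lt_vertices F N Hf HF'). lia.
Qed.

(** [H a] is the common point of the nested balls along the branch [a]. A forest on sequences
    becomes a forest on words at any level that separates its finitely many vertices, and the balls
    of that level already force independence. *)
Lemma perturb_cantor_map (G : (nat -> bool) -> pt) (n0 : nat) (eps : R) :
  (forall a, E (G a)) -> 0 < eps -> (forall a b, agree n0 a b -> dist (G a) (G b) < eps) ->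
  exists H : (nat -> bool) -> pt, (forall a, E (H a)) /\
    (forall a, dist (G a) (H a) < 2 * eps) /\
    (forall a d, 0 < d -> exists n, forall b, agree n a b -> dist (H b) (H a) < d) /\
    (forall F, forest distinct F -> D (length F) -> lin_indep (diffs (map_edges H F))).
Proof.
  intros HG Heps Hunif.
  assert (Hstep : exists step : nat * ((list bool -> pt) * R) -> (list bool -> pt) * R,
    forall p, (forall v, E (fst (snd p) v)) -> 0 < snd (snd p) ->
      shrinks (fst (snd p)) (snd (snd p)) (fst (step p)) (snd (step p)) /\
      forall F, on_vertices (fun s => length s = fst p) F -> forest distinct F -> D (length F) ->
        forall x, inside (fst (step p)) (snd (step p)) x -> lin_indep (diffs (map_edges x F))).
  { apply (functional_choice (fun p q => (forall v, E (fst (snd p) v)) -> 0 < snd (snd p) ->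
      shrinks (fst (snd p)) (snd (snd p)) (fst q) (snd q) /\
      forall F, on_vertices (fun s => length s = fst p) F -> forest distinct F -> D (length F) ->
        forall x, inside (fst q) (snd q) x -> lin_indep (diffs (map_edges x F)))).
    intros (n, (u, r)). simpl.
    destruct (classic ((forall v, E (u v)) /\ 0 < r)) as [[Hu Hr]|N].
    - destruct (level_perturb n u r Hu Hr) as (u' & r' & P). exists (u', r'). auto.
    - exists (u, r). tauto. }
  destruct Hstep as (step & Hstep).
  assert (Hext : exists ext : list bool -> nat -> bool, forall a, prefix (ext (prefix a n0)) n0 = prefix a n0).
  { destruct (functional_choice (fun s a => length s = n0 -> prefix a n0 = s)) as (ext & He).
    - intros s. destruct (classic (exists a, prefix a n0 = s)) as [(a & Ha)|N]; [now exists a|].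
      exists (fun i => nth (n0 - 1 - i) s true). intros Hl. exfalso. apply N.
      exists (fun i => nth (n0 - 1 - i) s true). clear - Hl. subst n0.
      induction s as [|b s IH]; [reflexivity|]. simpl length. simpl prefix. f_equal.
      + now replace (length s - 0 - length s)%nat with 0%nat by lia.
      + etransitivity; [|exact IH]. apply prefix_agree. intros i Hi.
        now replace (length s - 0 - i)%nat with (S (length s - 1 - i)) by lia.
    - exists ext. intros a. apply He, length_prefix. }
  destruct Hext as (ext & Hext).
  (* The initial centres sample [G] on words of length [n0]. At each later level a node starts from
     the centre of its parent, [tl s] dropping the newest bit, and the perturbation separates the
     children. *)
  set (st := fix st k := match k with
    | 0%nat => (fun s => G (ext s), eps)
    | S k' => step (S k' + n0, (fun s => fst (st k') (tl s), snd (st k')))%nat end).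
  set (u := fun k => fst (st k)). set (r := fun k => snd (st k)).
  assert (Hval : forall k, (forall v, E (u k v)) /\ 0 < r k).
  { induction k as [|k [IH1 IH2]]; [split; [intros v; apply HG|exact Heps]|].
    destruct (Hstep (S k + n0, (fun s => u k (tl s), r k))%nat) as ((H1 & H2) & _);
      [intros v; apply IH1|exact IH2|].
    split; [intros v; apply H2|exact H1]. }
  assert (Hsh : forall k, shrinks (fun s => u k (tl s)) (r k) (u (S k)) (r (S k)) /\
    forall F, on_vertices (fun s => length s = S k + n0)%nat F -> forest distinct F -> D (length F) ->
      forall x, inside (u (S k)) (r (S k)) x -> lin_indep (diffs (map_edges x F))).
  { intros k. apply (Hstep (S k + n0, (fun s => u k (tl s), r k))%nat);
      [intros v; apply (Hval k)|apply Hval]. }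
  set (x := fun a k => u k (prefix a (k + n0))).
  assert (Ex : forall a k, E (x a k)) by (intros; apply Hval).
  assert (Hx1 : forall a k, dist (x a k) (x a (S k)) + 2 * r (S k) <= r k).
  { intros a k. destruct (Hsh k) as [[_ H] _]. exact (proj2 (H (prefix a (S k + n0)))). }
  assert (Hx : forall a k j, dist (x a k) (x a (j + k)%nat) + r (j + k)%nat <= r k).
  { intros a k. induction j as [|j IH]; simpl; [rewrite dist_refl; lra|].
    generalize (Hx1 a (j + k)%nat) (dist_tri (x a k) (x a (j + k)%nat) (x a (S (j + k)))
      (amb_l2 _ _ amb _ (Ex a k)) (amb_l2 _ _ amb _ (Ex a (j + k)%nat))
      (amb_l2 _ _ amb _ (Ex a (S (j + k))))) (proj2 (Hval (S (j + k)))). lra. }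
  assert (Hr : forall d, 0 < d -> exists k, r k < d).
  { intros d Hd.
    (* The factor 2 in [shrinks] at least halves the radius at each level. *)
    assert (Hk : forall k, r k <= eps * (/ 2) ^ k).
    { induction k as [|k IH]; [simpl; unfold r; simpl; lra|].
      generalize (Hx1 (fun _ => true) k) (dist_pos (x (fun _ => true) k) (x (fun _ => true) (S k))).
      simpl. lra. }
    destruct (pow_lt_1_zero (/ 2)) with (y := d / eps) as (k & Hlt);
      [rewrite Rabs_pos_eq; lra|now apply Rdiv_lt_0_compat|].
    exists k. eapply Rle_lt_trans; [apply Hk|]. specialize (Hlt k (le_n k)).
    apply Rlt_le_trans with (eps * (d / eps)); [|right; field; lra].
    apply Rmult_lt_compat_l; [exact Heps|]. eapply Rle_lt_trans; [apply Rle_abs|exact Hlt]. }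
  assert (HH : exists H : (nat -> bool) -> pt, forall a, E (H a) /\ forall k, dist (x a k) (H a) < r k).
  { apply (functional_choice (fun a h => E h /\ forall k, dist (x a k) h < r k)). intros a.
    destruct (l2_complete (x a) r) as (y & Ly & Hy); [intros k; eapply amb_l2; eauto| |exact Hr|].
    { intros k j. generalize (Hx a k j) (proj2 (Hval (j + k)%nat)). lra. }
    exists y. split.
    - apply (amb_closed _ _ amb); [exact Ly|]. intros d Hd. destruct (Hr d Hd) as (k & Hk).
      exists (x a k). split; [apply Ex|]. eapply Rle_lt_trans; [apply Hy|exact Hk].
    - intros k. generalize (Hx1 a k) (Hy (S k)) (proj2 (Hval (S k)))
        (dist_tri (x a k) (x a (S k)) y (amb_l2 _ _ amb _ (Ex a k)) (amb_l2 _ _ amb _ (Ex a (S k))) Ly).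
      lra. }
  destruct HH as (H & HH). assert (EH : forall a, E (H a)) by (intros; apply HH).
  exists H. split; [exact EH|]. split; [|split].
  - intros a. destruct (HH a) as [_ H0]. specialize (H0 0%nat).
    change (x a 0%nat) with (G (ext (prefix a n0))) in H0. change (r 0%nat) with eps in H0.
    assert (A : agree n0 a (ext (prefix a n0))) by (apply prefix_agree; symmetry; apply Hext).
    specialize (Hunif _ _ A).
    generalize (dist_tri (G a) (G (ext (prefix a n0))) (H a) (amb_l2 _ _ amb _ (HG _))
      (amb_l2 _ _ amb _ (HG _)) (amb_l2 _ _ amb _ (EH a))). lra.
  - intros a d Hd. destruct (Hr (d / 2)) as (k & Hk); [lra|]. exists (k + n0)%nat. intros b Hab.
    apply prefix_agree in Hab.
    destruct (HH a) as [_ Ha]. destruct (HH b) as [_ Hb]. specialize (Ha k). specialize (Hb k).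
    unfold x in Ha, Hb. rewrite <- Hab, dist_sym in Hb.
    generalize (dist_tri (H b) (u k (prefix a (k + n0))) (H a) (amb_l2 _ _ amb _ (EH b))
      (amb_l2 _ _ amb _ (Ex a k)) (amb_l2 _ _ amb _ (EH a))). lra.
  - intros F Hf HD.
    set (V := map fst F ++ map snd F).
    assert (HV : on_vertices (fun v => In v V) F).
    { intros e He. unfold V. rewrite !in_app_iff. split; [left | right]; now apply in_map. }
    (* The successor matters: only the levels after the initial one have been perturbed. *)
    destruct (finite_separation V) as (m & Hm). set (k := (S m + n0)%nat).
    assert (Hk : forall v w, In v V -> In w V -> prefix v k = prefix w k -> v = w).
    { apply Hm. unfold k. lia. }
    (* [inside] concerns all words, so the values of [H] at the vertices of [F] are completed by the
       centres of the remaining balls. *)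
    assert (Hy : exists y : list bool -> pt, forall s,
      (exists a, In a V /\ prefix a k = s /\ y s = H a) \/
      (~ (exists a, In a V /\ prefix a k = s) /\ y s = u (S m) s)).
    { apply (functional_choice (fun s p => (exists a, In a V /\ prefix a k = s /\ p = H a) \/
        (~ (exists a, In a V /\ prefix a k = s) /\ p = u (S m) s))). intros s.
      destruct (classic (exists a, In a V /\ prefix a k = s)) as [(a & Va & Ha)|N].
      - exists (H a). left. eauto.
      - exists (u (S m) s). right. auto. }
    destruct Hy as (y & Hy).
    assert (HyV : forall a, In a V -> y (prefix a k) = H a).
    { intros a Va. destruct (Hy (prefix a k)) as [(b & Vb & Hb & ->)|[N _]]; [|exfalso; eauto].
      f_equal. now apply Hk. }
    replace (map_edges H F) with (map_edges y (map_edges (fun a => prefix a k) F)).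
    2:{ unfold map_edges. rewrite map_map. apply map_ext_in. intros e He. destruct (HV e He) as [V1 V2].
        now rewrite <- (HyV _ V1), <- (HyV _ V2). }
    apply (proj2 (Hsh m)).
    + intros e He. apply in_map_iff in He. destruct He as (e' & <- & _). split; apply length_prefix.
    + apply (forest_map _ (fun v => In v V) distinct); auto.
    + unfold map_edges. now rewrite length_map.
    + intros s. destruct (Hy s) as [(a & Va & <- & ->)|[_ ->]].
      * split; [apply EH|]. apply (HH a).
      * split; [apply Hval|]. rewrite dist_refl. apply Hval.
Qed.

Lemma general_dense (K : pt -> Prop) (eps : R) : D 1%nat -> is_cantor E K -> 0 < eps ->
  exists L, is_cantor E L /\ general D L /\ hausdorff K L < eps.
Proof.
  intros D1 HK Heps. destruct (is_cantor_param E K HK) as (G & HG). destruct HK as [HK _].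
  assert (K2 : forall x, K x -> l2 x) by (intros y Hy; eapply amb_l2; eauto).
  assert (GE : forall a, E (G a)) by (intros a; apply HK, HG).
  (* The perturbation moves points by less than twice [eps / 4]; the resulting non-strict Hausdorff
     bound [eps / 2] is still below [eps]. *)
  destruct (cantor_map_uniform K G (eps / 4) K2 HG) as (n0 & Hn0); [lra|].
  destruct (perturb_cantor_map G n0 (eps / 4) GE) as (H & EH & Hd & Hc & Hi); [lra|exact Hn0|].
  assert (HL : cantor_param (fun x => exists a, H a = x) H).
  { split; [eauto|]. split; [auto|]. split; [|exact Hc].
    intros a b Hab. apply NNPP. intros N.
    (* Injectivity of [H] is independence of a one-edge forest, hence the assumption [D 1]. *)
    assert (I1 : lin_indep (diffs (map_edges H [(a, b)]))).
    { apply Hi; [|exact D1]. simpl. repeat split; try tauto; auto. }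
    apply lin_indep_cons in I1. destruct I1 as [I1 _]. apply I1. simpl.
    apply in_span_nil. intros n. rewrite Hab. ring. }
  exists (fun x => exists a, H a = x). split; [|split].
  - apply (is_cantor_of_param E _ H); [|apply (amb_l2 _ _ amb)|exact HL]. intros x (a & <-). apply EH.
  - intros F HF Hf HD.
    (* A section of [H] pulls a forest of points back to a forest of sequences. *)
    destruct (functional_choice (fun x a => (exists b, H b = x) -> H a = x)) as (c & Hcx).
    { intros x. destruct (classic (exists b, H b = x)) as [(b & Hb)|N]; [now exists b|].
      exists (fun _ => true). tauto. }
    replace F with (map_edges H (map_edges c F)).
    2:{ unfold map_edges. rewrite map_map. rewrite <- (map_id F) at 2. apply map_ext_in.
        intros (a, b) He. simpl. destruct (HF _ He). now rewrite !Hcx. }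
    apply Hi.
    + apply (forest_map c (fun x => exists a, H a = x) distinct); auto.
      intros x y Hx Hy N Hc'. apply N. rewrite <- (Hcx x Hx), <- (Hcx y Hy). now rewrite Hc'.
    + unfold map_edges. now rewrite length_map.
  - apply Rle_lt_trans with (eps / 2); [|lra].
    apply (hausdorff_le_of_param K _ G H); auto. intros a. specialize (Hd a). lra.
Qed.

End Perturbation.

(** * The two ambient spaces *)


Lemma dense_Gdelta_of_gp_upto (E : pt -> Prop) (D : nat -> Prop) (P : (pt -> Prop) -> Prop) :
  ambient E D -> D 1%nat -> (forall M, is_cantor E M -> (P M <-> gp_upto E D M)) ->
  dense_Gdelta_in_C E (fun M => is_cantor E M /\ P M).
Proof.
  intros amb D1 HP.
  assert (HG : forall M, is_cantor E M -> (P M <-> general D M)).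
  { intros M HM. rewrite HP by exact HM.
    split; [apply gp_general | apply general_gp]; auto; apply HM. }
  split; [tauto|]. split.
  - exists (robust E D). split; [intros n; now apply robust_is_open|].
    intros K HK. rewrite HG by exact HK. split.
    + intros [_ H] n. now apply general_robust.
    + intros H. split; [exact HK|]. apply (robust_general E D amb K); [apply HK|exact H].
  - intros K HK eps Heps.
    destruct (general_dense E D amb K eps D1 HK Heps) as (L & HL & Hg & Hd).
    exists L. rewrite HG; auto.
Qed.

Definition unit_vec (k : nat) : pt := fun n => if Nat.eq_dec n k then 1 else 0.

Fixpoint std_basis (k : nat) : list pt :=
  match k with 0%nat => [] | S k => unit_vec k :: std_basis k end.

Lemma length_std_basis (k : nat) : length (std_basis k) = k.
Proof. induction k; simpl; congruence. Qed.

Lemma span_std_basis (k : nat) (x : pt) : in_span (std_basis k) x <-> RN k x.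
Proof.
  revert x. induction k as [|k IH]; intros x; simpl.
  - rewrite in_span_nil. split; [intros H n _; auto | intros H n; apply H; lia].
  - rewrite in_span_cons. unfold unit_vec. split.
    + intros (c & s & Hs & E) n Hn. apply IH in Hs. rewrite E, Hs by lia.
      destruct (Nat.eq_dec n k); [lia|ring].
    + intros H. exists (x k), (fun n => if Nat.eq_dec n k then 0 else x n). split.
      * apply IH. intros n Hn. destruct (Nat.eq_dec n k); [reflexivity|]. apply H. lia.
      * intros n. destruct (Nat.eq_dec n k) as [->|]; ring.
Qed.

Lemma lin_indep_std_basis (k : nat) : lin_indep (std_basis k).
Proof.
  induction k as [|k IH]; [apply lin_indep_nil|].
  apply lin_indep_cons. split; [|exact IH]. rewrite span_std_basis. intros H.
  specialize (H k (le_n k)). unfold unit_vec in H. destruct (Nat.eq_dec k k); [lra|congruence].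
Qed.

Lemma std_basis_RN (k : nat) (v : pt) : In v (std_basis k) -> RN k v.
Proof. intros H. apply span_std_basis. now apply in_span_In. Qed.

Lemma RN_l2 (N : nat) (x : pt) : RN N x -> l2 x.
Proof.
  intros H. apply (ex_series_incr_n (fun i => x i ^ 2) N).
  apply (ex_series_ext (fun _ => 0 ^ 2)); [|exact l2_0].
  intros n. now rewrite H by lia.
Qed.

Lemma not_spanning (vs : list pt) (k : nat) : (length vs < k)%nat ->
  exists x, RN k x /\ ~ in_span vs x.
Proof.
  intros Hl. apply NNPP. intros N. apply (Nat.lt_irrefl k).
  eapply Nat.le_lt_trans; [|exact Hl]. rewrite <- (length_std_basis k) at 1.
  apply steinitz; [apply lin_indep_std_basis|]. intros w Hw. apply NNPP. intros Nw.
  apply N. exists w. split; [now apply std_basis_RN|exact Nw].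
Qed.

Lemma ambient_RN (N : nat) : ambient (RN N) (fun e => (e <= N)%nat).
Proof.
  split.
  - apply RN_l2.
  - intros i _. reflexivity.
  - intros c x y Hx Hy i Hi. rewrite Hx, Hy by exact Hi. ring.
  - intros x Lx H i Hi. apply NNPP. intros Nz.
    destruct (H (Rabs (x i))) as (y & Hy & Hd); [now apply Rabs_pos_lt|].
    rewrite dist_norm in Hd.
    generalize (coord_le_norm _ i (l2_sub y x (RN_l2 N y Hy) Lx)). cbv beta.
    rewrite Hy by exact Hi. replace (0 - x i) with (- x i) by ring. rewrite Rabs_Ropp. lra.
  - intros m n Hmn Hn. lia.
  - intros vs H. now apply not_spanning.
Qed.

Lemma ambient_l2 : ambient l2 (fun _ => True).
Proof.
  split; auto.
  - apply l2_0.
  - apply l2_lin.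
  - intros vs _. destruct (not_spanning vs (S (length vs))) as (x & Hx & Nx); [lia|].
    exists x. split; [eapply RN_l2; eauto|exact Nx].
Qed.

(** A vector outside the span extends [vs] to an independent list inside R^N, to which Steinitz
    applies. This translates properness of H into the length condition of [gp_upto]. *)
Lemma proper_span_iff (N : nat) (vs : list pt) : (forall v, In v vs -> RN N v) -> lin_indep vs ->
  ((exists x, RN N x /\ ~ in_span vs x) <-> (S (length vs) <= N)%nat).
Proof.
  intros Hvs Hi. split; [|apply not_spanning].
  intros (x & Hx & Nx).
  change (length (x :: vs) <= N)%nat. rewrite <- (length_std_basis N).
  apply steinitz; [now apply lin_indep_cons|].
  intros w Hw. apply span_std_basis. destruct Hw as [<-|Hw]; auto.
Qed.

Theorem mainTheorem1 :
  (forall N : nat, (2 <= N)%nat ->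
     dense_Gdelta_in_C (RN N) (fun M => is_cantor (RN N) M /\ gp_all_proj_RN N M)) /\
  dense_Gdelta_in_C l2 (fun M => is_cantor l2 M /\ gp_all_fin_proj_l2 M).
Proof.
  split.
  - intros N HN.
    apply (dense_Gdelta_of_gp_upto (RN N) (fun e => (e <= N)%nat)); [apply ambient_RN|lia|].
    intros M _. unfold gp_all_proj_RN, gp_upto.
    split; intros H vs Hvs Hi Hne Hp; apply H; auto; now apply proper_span_iff.
  - apply (dense_Gdelta_of_gp_upto l2 (fun _ => True)); [apply ambient_l2|exact I|].
    intros M _. unfold gp_all_fin_proj_l2, gp_upto. split; intros H vs; intros; apply H; auto.
Qed.
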